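(* For every $c>0$ and every finite graph $H$, there exists a constant $C$ such that for every positive integer $t$, if $G$ is a finite $(c,t)$-sparse graph with average degree at least $Ct$, then $G$ contains an induced subdivision of $H$.
   Context: A graph $G$ is $(c,t)$-sparse if for all (not necessarily disjoint) subsets $A,B\subseteq V(G)$ with $|A|,|B|\geq t$ we have $e(A,B)\leq(1-c)|A||B|$, where $e(A,B)$ is the number of pairs $(a,b)\in A\times B$ joined by an edge. A subdivision of $H$ is any graph obtained from $H$ by replacing its edges by (internally vertex-disjoint) paths; an induced subdivision of $H$ in $G$ is an induced subgraph of $G$ isomorphic to a subdivision of $H$. *)

(* Defs.v *)
From HB Require Import structures.
From mathcomp Require Import all_boot all_order all_algebra.
From mathcomp Require Import reals.

Set Implicit Arguments.
Unset Strict Implicit.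
Unset Printing Implicit Defensive.

Import Order.TTheory GRing.Theory Num.Theory.

Record sgraph := SGraph {
  vertex :> finType;
  adj : rel vertex;
  adj_sym : symmetric adj;
  adj_irrefl : irreflexive adj
}.

Arguments adj {G} : rename.

Definition degree (G : sgraph) (v : G) : nat := #|[set w | adj v w]|.

(* On the graph with no vertices this is 0 / 0 = 0. *)
Definition average_degree (R : realType) (G : sgraph) : R :=
  ((\sum_(v : G) degree v)%N%:R / #|G|%:R)%R.

(* Ordered pairs: an edge with both ends in A :&: B is counted twice. *)
Definition edges_between (G : sgraph) (A B : {set G}) : nat :=
  #|[set ab in setX A B | adj ab.1 ab.2]|.

Definition sparse (R : realType) (c : R) (t : nat) (G : sgraph) : Prop :=
  forall A B : {set G}, t <= #|A| -> t <= #|B| ->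
    ((edges_between A B)%:R <= (1 - c) * #|A|%:R * #|B|%:R)%R.

Section InducedSubgraph.
Variables (G : sgraph) (A : {set G}).

Definition induced_adj : rel {x : G | x \in A} :=
  fun x y => adj (val x) (val y).

Lemma induced_adj_sym : symmetric induced_adj.
Proof. by move=> x y; apply: adj_sym. Qed.

Lemma induced_adj_irrefl : irreflexive induced_adj.
Proof. by move=> x; apply: adj_irrefl. Qed.

Definition induced_subgraph : sgraph :=
  SGraph induced_adj_sym induced_adj_irrefl.

End InducedSubgraph.

Definition isomorphic (G H : sgraph) : Prop :=
  exists2 f : G -> H, bijective f & forall x y, adj (f x) (f y) = adj x y.

(* [branch] sends the vertices of H to the branch vertices of S, and
   [inner u v] lists, in order from [branch u] to [branch v], the internal
   vertices of the path replacing the edge uv of H; it is empty when the edge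
   is left unchanged.  Its values at nonadjacent u, v are irrelevant. *)
Definition subdivision_path (H S : sgraph) (branch : H -> S)
    (inner : H -> H -> seq S) (u v : H) : seq S :=
  branch u :: rcons (inner u v) (branch v).

Record subdivision_model (H S : sgraph) (branch : H -> S)
    (inner : H -> H -> seq S) : Prop := SubdivisionModel {
  branch_inj : injective branch;
  (* Both orientations of an edge give the same path. *)
  inner_rev : forall u v, adj u v -> inner v u = rev (inner u v);
  inner_uniq : forall u v, adj u v -> uniq (inner u v);
  inner_branch : forall u v w, adj u v -> branch w \notin inner u v;
  inner_disjoint : forall u v u' v' x, adj u v -> adj u' v' ->
    x \in inner u v -> x \in inner u' v' -> [set u; v] = [set u'; v'];
  vertex_cover : forall x : S, (exists u, x = branch u) \/
    (exists u v, adj u v /\ x \in inner u v);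
  (* The edges of S are exactly the pairs of consecutive path vertices. *)
  edge_cover : forall x y : S, adj x y <->
    exists u v, adj u v /\ infix [:: x; y] (subdivision_path branch inner u v)
}.

Definition is_subdivision (S H : sgraph) : Prop :=
  exists (branch : H -> S) (inner : H -> H -> seq S),
    subdivision_model branch inner.

Definition contains_induced_subdivision (G H : sgraph) : Prop :=
  exists (A : {set G}) (S : sgraph),
    is_subdivision S H /\ isomorphic (induced_subgraph A) S.

(* Main.v *)
Require Import Defs.
From HB Require Import structures.
From mathcomp Require Import all_boot all_order all_algebra.
From mathcomp Require Import reals zify ring lra.

Set Implicit Arguments.
Unset Strict Implicit.
Unset Printing Implicit Defensive.

Import Order.TTheory GRing.Theory Num.Theory.

(** Say that a graph has a dense linkage if it has independent sets X and M such
    that at least D|X| ordered pairs of vertices of X are linked, that is, some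
    a in M has exactly these two neighbours in X.  Joining the linked pairs
    gives a graph F on X whose 1-subdivision is an induced subgraph.  If D is
    large, F contains a subdivision of H as a subgraph by Mader's theorem
    [dense_topo_model]; subdividing its edges once more turns it into an induced
    subdivision of H, since an edge of the original graph must join a vertex of
    M to one of its two neighbours in X [dense_linkage_subdivision].  So a
    dense linkage has to be found.

    Sparseness is used only through [nonadjacency_rich]: among any t vertices
    some vertex misses a fixed proportion 1/q of any given set W of size at
    least t.  Hence a greedy or random choice can make vertices nonadjacent while
    losing constant factors, as long as the sets involved have size at least a
    large multiple of t.  In particular two sets that large with a positive
    density of edges between them yield a linkage of any constant size
    [dense_pair_linkage].  From now on no such pair is available.

    Pass to a subset S of maximal density, with about m|S| ordered pairs of adjacent
    vertices, where m is at least Ct; every subset then has density at most about m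
    [densest_subset].  Let Hi be the vertices of S of degree above Km.  There are
    at most 2|S|/K of them, and one of two things happens.

    Either a constant proportion of the edges avoids Hi, and S minus Hi is
    almost regular [regular_case].  As no dense pair exists, few pairs of vertices have a
    common neighbourhood of size comparable to m, so a random subset of density
    about 1/m times a large constant has few triangles and four-cycles.  Deleting
    them leaves a graph of girth at least five with bounded degree and large
    average degree l [girth_five_subset].  In it a second, sparser random set U,
    of density of order 1/l^2 times a constant, works: the paths of length two
    between vertices of U outnumber U, and most of them are disturbed by nothing
    else in U [girth_five_linkage].

    Or a constant proportion of the edges joins Hi to the rest, which is far
    larger than Hi; let A be the rest [unbalanced_case].  Sparseness gives about m^2 nonadjacent pairs in the
    neighbourhood in Hi of a typical a in A.  After removing from Hi the vertices
    that lie in few such pairs [cleaned_side], the absence of dense pairs shows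
    that they remain numerous when each pair is counted for at most m vertices
    a.  A random set of density of order 1/m then keeps many triples (a, b, b') such that a has
    exactly the neighbours b, b' in the set; independence on both sides comes
    from ordering the vertices so that each has at most 2m smaller neighbours
    [degenerate_order, unbalanced_linkage]. *)

(** * Counting edges *)

Definition nbr (T : finType) (e : rel T) (x : T) : {set T} := [set y | e x y].

Definition edge_count (T : finType) (e : rel T) (A B : {set T}) : nat :=
  \sum_(x in A) #|nbr e x :&: B|.

Section EdgeCount.
Variables (T : finType) (e : rel T).
Hypothesis e_sym : symmetric e.

Lemma in_nbr x y : (y \in nbr e x) = e x y.
Proof. by rewrite inE. Qed.

Lemma card_setsum (A : {set T}) (P : pred T) : #|[set x in A | P x]| = \sum_(x in A) P x.
Proof.
rewrite -sum1_card big_mkcond [RHS]big_mkcond /=; apply: eq_bigr => x _.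
by rewrite inE; case: (x \in A); case: (P x).
Qed.

Lemma card_setIE (A : {set T}) (B : {set T}) : #|B :&: A| = \sum_(x in A) (x \in B).
Proof.
rewrite -(card_setsum A (fun x => x \in B)); congr #|pred_of_set _|.
by apply/setP => x; rewrite !inE andbC.
Qed.

Lemma edge_countE A B : edge_count e A B = \sum_(x in A) \sum_(y in B) e x y.
Proof.
apply: eq_bigr => x _; rewrite card_setIE; apply: eq_bigr => y _.
by rewrite inE.
Qed.

Lemma edge_countC A B : edge_count e A B = edge_count e B A.
Proof.
rewrite !edge_countE exchange_big /=; apply: eq_bigr => x _; apply: eq_bigr => y _.
by rewrite e_sym.
Qed.

Lemma edge_countSr (A B C : {set T}) :
  B \subset C -> edge_count e A B <= edge_count e A C.
Proof. by move=> sBC; apply: leq_sum => x _; rewrite subset_leq_card // setIS. Qed.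

Lemma edge_countSl (A B C : {set T}) :
  A \subset B -> edge_count e A C <= edge_count e B C.
Proof. by move=> sAB; rewrite edge_countC [leqRHS]edge_countC edge_countSr. Qed.

Lemma edge_countD1 (Y : {set T}) w : irreflexive e -> w \in Y ->
  edge_count e Y Y = edge_count e (Y :\ w) (Y :\ w) + 2 * #|nbr e w :&: Y|.
Proof.
move=> irr Yw; rewrite {1}/edge_count (big_setD1 w) //=.
have E1 x : x \in Y :\ w -> #|nbr e x :&: Y| = (e x w) + #|nbr e x :&: (Y :\ w)|.
  move=> _; rewrite (cardsD1 w) in_setI Yw andbT inE; congr (_ + _).
  by congr #|pred_of_set _|; apply/setP => y; rewrite !inE; case: (y == w); rewrite ?andbF.
rewrite (eq_bigr _ E1) big_split /= addnA addnC; congr (_ + _).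
have -> : \sum_(i in Y :\ w) (e i w) = #|nbr e w :&: Y|.
  have -> : nbr e w :&: Y = nbr e w :&: (Y :\ w).
    by apply/setP => y; rewrite !inE; case: eqP => //= ->; rewrite irr.
  by rewrite card_setIE; apply: eq_bigr => y _; rewrite inE e_sym.
lia.
Qed.

End EdgeCount.

(** * Topological minors in dense graphs *)

(** The pairs in [es] are the edges of H, each listed in one orientation.
    Inner paths are required to be nonempty so that an edge of the host graph
    lies on at most one of the paths. *)
Record topo_model (T : finType) (e : rel T) (X : {set T}) (H : finType)
    (es : seq (H * H)) (br : H -> T) (P : H * H -> seq T) : Prop := TopoModel {
  topo_inj : injective br;
  topo_br : forall h, br h \in X;
  topo_path : forall uv, uv \in es -> path e (br uv.1) (rcons (P uv) (br uv.2));
  topo_nonempty : forall uv, uv \in es -> P uv != [::];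
  topo_sub : forall uv, uv \in es -> {subset P uv <= X};
  topo_uniq : forall uv, uv \in es -> uniq (P uv);
  topo_avoid : forall uv h, uv \in es -> br h \notin P uv;
  topo_disj : forall uv uv' x, uv \in es -> uv' \in es ->
    x \in P uv -> x \in P uv' -> uv = uv'
}.

Section MaderStep.
Variables (T : finType) (e : rel T).
Hypotheses (e_sym : symmetric e) (e_irr : irreflexive e).

Definition connected_in (U : {set T}) :=
  [forall x in U, forall y in U,
     connect [rel a b | [&& a \in U, b \in U & e a b]] x y].

Lemma connected_inP U x y : connected_in U -> x \in U -> y \in U ->
  exists p, [/\ path e x p, last x p = y, {subset x :: p <= U} & uniq (x :: p)].
Proof.
move=> /forall_inP /(_ x) cU Ux Uy; have /forall_inP /(_ y Uy) := cU Ux.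
move=> /connectP [p0 pth ->]; case/shortenP: pth => p pth up _.
exists p; split=> //.
  by apply: sub_path pth => a b /= /and3P [].
elim: p x {cU up} Ux pth => [|b p IH] x Ux /=.
  by move=> _ z; rewrite inE => /eqP ->.
move=> /andP [/and3P [_ Ub _] pth] z; rewrite inE => /orP [/eqP -> //|].
exact: IH.
Qed.

Lemma connected_in1 x : connected_in [set x].
Proof.
by apply/forall_inP => y /set1P ->; apply/forall_inP => z /set1P ->; apply: connect0.
Qed.

Definition outer (X U : {set T}) : {set T} :=
  [set w in X :\: U | [exists u in U, e w u]].

Lemma connected_inU1 (X U : {set T}) w :
  connected_in U -> w \in outer X U -> connected_in (w |: U).
Proof.
move=> cU; rewrite inE => /andP [_ /exists_inP [u Uu ewu]].
set r := [rel a b | [&& a \in w |: U, b \in w |: U & e a b]].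
have rs : connect_sym r.
  by apply: sym_connect_sym => a b /=; rewrite e_sym andbCA.
have rU y : y \in U -> connect r u y.
  move=> Uy; have [p [pth <- sp _]] := connected_inP cU Uu Uy.
  apply/connectP; exists p => //.
  elim: p u {ewu Uy} Uu pth sp => //= b p IH u Uu /andP [eub pth] sp.
  have Ub : b \in U by apply: sp; rewrite !inE eqxx orbT.
  rewrite !inE Uu Ub eub !orbT /= IH // => z zp; apply: sp; rewrite inE zp orbT //.
have ru y : y \in w |: U -> connect r u y.
  rewrite in_setU1 => /orP [/eqP ->|]; last exact: rU.
  by apply: connect1; rewrite /= !inE eqxx Uu orbT e_sym ewu.
apply/forall_inP => y Uy; apply/forall_inP => z Uz.
by apply: connect_trans (ru _ Uz); rewrite rs ru.
Qed.

Lemma outerU1 (X U : {set T}) w : w \in outer X U ->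
  outer X (w |: U) =
  (outer X U :\ w) :|: (nbr e w :&: (X :\: U :\: outer X U)).
Proof.
move=> ow; have := ow; rewrite inE in_setD => /andP [/andP [Uw Xw] _].
apply/setP => y; rewrite !inE.
have -> : [exists u in w |: U, e y u] = e w y || [exists u in U, e y u].
  apply/exists_inP/orP => [[u]|[ewy|/exists_inP [u Uu eyu]]].
  - rewrite in_setU1 => /orP [/eqP -> ewy|Uu eyu]; first by rewrite e_sym; left.
    by right; apply/exists_inP; exists u.
  - by exists w; rewrite ?inE ?eqxx // e_sym.
  - by exists u; rewrite ?inE ?Uu ?orbT.
case: (eqVneq y w) => [->|_] /=; rewrite ?e_irr //=.
by case: (y \in U); case: (y \in X); case: (e w y); case: [exists u in U, e y u].
Qed.

(** The quantity that Mader's maximality argument compares before and after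
    adding a vertex w to the contracted set: [a] is the number of neighbours of
    w that are already adjacent to the set, [b] the number of those that are
    not, and [dk] stands for d times the number of remaining vertices. *)
Fact contraction_excess d D dk E' a b o : d = 2 * D + 2 ->
  d + dk + d <= E' + 2 * (a + b) + 2 * (1 + o) -> E' + 2 * (o + b) < dk + d -> D <= a.
Proof. by lia. Qed.

(** Mader's contraction argument: contract a connected set U as large as
    possible without losing average degree.  Absorbing one more vertex w of the
    boundary of U loses an edge for every neighbour of w in the boundary, so by
    maximality w has many of them: the boundary of U is dense itself, and any
    two of its vertices can be joined through U.  If the boundary
    is empty, the rest of X is smaller and still dense enough, and replaces X. *)
Lemma dense_neighbourhood (D : nat) (X : {set T}) :
  X != set0 -> (2 * D + 2) * #|X| <= edge_count e X X ->
  exists X' U : {set T}, [/\ X' \subset X, U \subset X, X' != set0,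
    connected_in U & [/\ [disjoint X' & U],
    forall w, w \in X' -> exists2 u, u \in U & e w u &
    D * #|X'| <= edge_count e X' X']].
Proof.
set d := 2 * D + 2.
move: {2}#|X| (leqnn #|X|) => n; elim: n X => [|n IH] X Xn X0 Xd.
  by move: Xn X0; rewrite leqn0 cards_eq0 => /eqP ->; rewrite eqxx.
pose good (U : {set T}) := [&& U \subset X, U != set0, connected_in U &
  d * (#|X :\: U| + 1) <= edge_count e (X :\: U) (X :\: U) + 2 * #|outer X U|].
have [x Xx] := set0Pn _ X0.
(* A singleton is good because its boundary consists of the neighbours of x. *)
have g1 : good [set x].
  rewrite /good sub1set Xx connected_in1 -cards_eq0 cards1 /= addn1.
  have := Xd; rewrite (cardsD1 x) Xx add1n (edge_countD1 e_sym e_irr Xx) => /leq_trans -> //.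
  rewrite leq_add2l leq_mul2l /= subset_leq_card //; apply/subsetP => y; rewrite !inE.
  case/andP => exy Xy; rewrite Xy andbT; apply/andP; split.
    by apply: contraTneq exy => ->; rewrite e_irr.
  by apply/exists_inP; exists x; rewrite ?inE // e_sym.
have [U mU] := ex_maxset (ex_intro good _ g1).
have [/and4P [UX U0 cU dU] maxU] := maxsetP mU.
have oX : outer X U \subset X by apply/subsetP => w; rewrite inE in_setD => /andP [/andP []].
(* An empty boundary would make X minus U a smaller dense set. *)
have [o0|o0] := eqVneq (outer X U) set0.
  rewrite o0 cards0 muln0 addn0 in dU.
  have XU : #|X :\: U| <= n.
    have [u Uu] := set0Pn _ U0.
    have := subset_leq_card UX; have : 0 < #|U| by rewrite card_gt0.
    by rewrite cardsD (setIidPr UX); lia.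
  have [X0'|X0'] := eqVneq (X :\: U) set0.
    by move: dU; rewrite X0' /edge_count big_set0 cards0 /d; lia.
  have [|X' [U' [sX' sU' ne cU' [dis con den]]]] := IH _ XU X0'; first by lia.
  exists X', U'; split=> //; by apply: subset_trans (subsetDl X U).
exists (outer X U), U; split=> //; split.
- by rewrite disjoint_subset; apply/subsetP => w; rewrite inE in_setD => /andP [/andP []].
- by move=> w; rewrite inE => /andP [_ /exists_inP [u]]; exists u.
rewrite /edge_count mulnC -sum_nat_const; apply: leq_sum => w ow.
have := ow; rewrite inE in_setD => /andP [/andP [Uw Xw] _].
have XUw : w \in X :\: U by rewrite inE Uw.
have : ~~ good (w |: U).
  apply/negP => gw; have := maxU _ gw (subsetUr _ _) => E.
  by rewrite -E setU11 in Uw.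
rewrite /good subUset sub1set Xw UX /= (connected_inU1 cU ow) /=.
have -> : w |: U != set0 by apply/set0Pn; exists w; rewrite setU11.
rewrite /= -ltnNge setDUr setIC.
have -> : (X :\: U) :&: (X :\ w) = X :\: U :\ w.
  by apply/setP => y; rewrite !inE; case: (y \in X); rewrite ?andbF ?andbT // andbC.
move: dU; rewrite (edge_countD1 e_sym e_irr XUw) outerU1 //.
rewrite (cardsD1 w (X :\: U)) XUw.
set k := #|X :\: U :\ w|; set E := edge_count _ _ _.
have -> : #|outer X U :\ w :|: nbr e w :&: (X :\: U :\: outer X U)| =
   #|outer X U :\ w| + #|nbr e w :&: (X :\: U :\: outer X U)|.
  rewrite cardsU; have -> : (outer X U :\ w) :&: (nbr e w :&: (X :\: U :\: outer X U)) = set0.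
    apply/setP => y; rewrite in_setI in_setD1 in_setI in_setD in_set0.
    by case: (y \in outer X U); rewrite ?andbF.
  by rewrite cards0 subn0.
have -> : #|nbr e w :&: (X :\: U)| = #|nbr e w :&: outer X U| + #|nbr e w :&: (X :\: U :\: outer X U)|.
  rewrite -(cardsID (outer X U) (nbr e w :&: (X :\: U))); congr (_ + _); last by rewrite -!setIDA.
  congr #|pred_of_set _|; rewrite -setIA; congr (_ :&: _).
  apply/setIidPr/subsetP => y; rewrite inE => /andP [->] //.
rewrite (cardsD1 w (outer X U)) ow !(mulnDr d) !muln1 => h1 h2.
exact: (contraction_excess (erefl d) h1 h2).
Qed.

End MaderStep.

(** Mader's theorem on topological minors: route all edges but one inside
    the dense boundary of a connected set U, and the last one through U. *)
Theorem dense_topo_model (H : finType) (es : seq (H * H)) : uniq es ->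
  exists D : nat, forall (T : finType) (e : rel T) (X : {set T}),
    symmetric e -> irreflexive e -> X != set0 -> D * #|X| <= edge_count e X X ->
    exists br P, topo_model e X es br P.
Proof.
elim: es => [_|[u v] es IH].
  exists #|H| => T e X e_sym e_irr X0 Xd.
  have [x Xx] := set0Pn _ X0.
  have xd : #|H| <= #|X|.
    rewrite leqNgt; apply/negP => lt; have : edge_count e X X <= #|X| * #|X|.
      rewrite -sum_nat_const; apply: leq_sum => y _; exact: subset_leq_card (subsetIr _ _).
    have : 0 < #|X| by rewrite card_gt0.
    nia.
  pose br (h : H) := nth x (enum X) (index h (enum H)).
  have bP h : index h (enum H) < size (enum X).
    by rewrite -cardE; apply: leq_trans xd; rewrite cardE index_mem mem_enum.
  exists br, (fun=> [::]); split=> //.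
  - move=> h h' /eqP; rewrite nth_uniq ?enum_uniq // => /eqP E.
    by rewrite -[h](nth_index h (s := enum H)) ?mem_enum // E nth_index ?mem_enum.
  - by move=> h; rewrite -mem_enum mem_nth.
rewrite /= => /andP [ues /IH [D HD]]; exists (2 * D + 2) => T e X e_sym e_irr X0 Xd.
have [X' [U [sX' sU X'0 cU [dis con den]]]] := dense_neighbourhood e_sym e_irr X0 Xd.
have [br [P tm]] := HD _ _ _ e_sym e_irr X'0 den.
have [x Ux ex] := con _ (topo_br tm u).
have [y Uy ey] := con _ (topo_br tm v).
have [p [pp lp sp up]] := connected_inP cU Ux Uy.
have nU z : z \in X' -> z \notin U by move=> Xz; rewrite (disjointFr dis Xz).
exists br, (fun uv => if uv == (u, v) then x :: p else P uv).
have neq uv : uv \in es -> (uv == (u, v)) = false.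
  by move=> h; apply: contraNF ues => /eqP <-.
have brU h : br h \notin x :: p.
  by apply: contraNN (nU _ (topo_br tm h)) => /sp.
split.
- exact: topo_inj tm.
- by move=> h; apply: (subsetP sX'); exact: topo_br tm h.
- move=> uv; rewrite inE; case: eqP => [-> _|_ /= /(topo_path tm) //].
  by rewrite /= ex /= rcons_path pp lp e_sym.
- by move=> uv; rewrite inE; case: eqP => // _ /= /(topo_nonempty tm).
- move=> uv; rewrite inE; case: eqP => [_ _ z /sp /(subsetP sU) //|_ /= h z].
  by move=> /(topo_sub tm h) /(subsetP sX').
- by move=> uv; rewrite inE; case: eqP => // _ /= /(topo_uniq tm).
- move=> uv h; rewrite inE; case: eqP => // _ /= /(topo_avoid tm); exact.
- move=> uv uv' z; rewrite !inE; case: eqP => [->|_] /=; case: eqP => [->|_] //=.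
  + by move=> _ h zp zP; have := nU z (topo_sub tm h zP); rewrite (sp _ zp).
  + by move=> h _ zP zp; have := nU z (topo_sub tm h zP); rewrite (sp _ zp).
  + exact: (topo_disj tm).
Qed.

(** * From linkages to induced subdivisions *)

(* Simplification would otherwise expose the fixpoint behind [infix]. *)
Local Arguments infix : simpl never.

Lemma prefix_map_inj (S T : eqType) (f : S -> T) s1 s2 : injective f ->
  prefix (map f s1) (map f s2) = prefix s1 s2.
Proof.
move=> fI; elim: s1 s2 => [|x s1 IH] [|y s2] //=.
by rewrite inj_eq // IH.
Qed.

Lemma infix_map_inj (S T : eqType) (f : S -> T) s1 s2 : injective f ->
  infix (map f s1) (map f s2) = infix s1 s2.
Proof.
move=> fI; elim: s2 => [|y s2 IH]; first by case: s1.
by rewrite [RHS]infix_consl -IH -(prefix_map_inj s1 (y :: s2) fI).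
Qed.

(** The image in G of an induced subdivision, described without mentioning the
    subtype of its vertices. *)
Record induced_model (G H : sgraph) (br : H -> G) (inn : H -> H -> seq G) : Prop :=
  InducedModel {
  im_inj : injective br;
  im_rev : forall u v, adj u v -> inn v u = rev (inn u v);
  im_uniq : forall u v, adj u v -> uniq (inn u v);
  im_br : forall u v w, adj u v -> br w \notin inn u v;
  im_disj : forall u v u' v' x, adj u v -> adj u' v' ->
    x \in inn u v -> x \in inn u' v' -> [set u; v] = [set u'; v'];
  im_adj : forall x y : G,
    (exists u, x = br u) \/ (exists u v, adj u v /\ x \in inn u v) ->
    (exists u, y = br u) \/ (exists u v, adj u v /\ y \in inn u v) ->
    (adj x y <-> exists u v, adj u v /\ infix [:: x; y] (subdivision_path br inn u v))
}.

Lemma induced_model_contains (G H : sgraph) (br : H -> G) inn :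
  induced_model br inn -> contains_induced_subdivision G H.
Proof.
move=> im.
pose A := [set x : G | [exists h, x == br h] ||
  [exists u : H, exists v : H, adj u v && (x \in inn u v)]].
have AP x : x \in A <-> (exists u, x = br u) \/ (exists u v, adj u v /\ x \in inn u v).
  rewrite inE; split.
    case/orP => [/existsP [h /eqP ->]|/existsP [u /existsP [v /andP [a b]]]].
      by left; exists h.
    by right; exists u, v.
  case=> [[u ->]|[u [v [a b]]]]; apply/orP; [left|right].
    by apply/existsP; exists u.
  by apply/existsP; exists u; apply/existsP; exists v; rewrite a.
have brA h : br h \in A by apply/AP; left; exists h.
have innA u v : adj u v -> {subset inn u v <= A}.
  by move=> uv x xi; apply/AP; right; exists u, v.
pose S := induced_subgraph A.
pose brS h : S := exist _ (br h) (brA h).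
pose inS u v : seq S := pmap insub (inn u v).
have mapS u v : adj u v -> map val (inS u v) = inn u v.
  move=> uv; rewrite /inS (pmap_filter (@insubK _ _ _)).
  by apply/all_filterP/allP => x xi; rewrite /= isSome_insub; apply: innA xi.
have memS u v x : adj u v -> (x \in inS u v) = (val x \in inn u v).
  by move=> uv; rewrite -(mapS u v uv) mem_map //; apply: val_inj.
exists A, S; split; last by exists id => //; exists id.
exists brS, inS; split.
- by move=> u v /(congr1 val) /(im_inj im).
- move=> u v uv; have vu : adj v u by rewrite adj_sym.
  have vI : injective (fun x : S => val x) by apply: val_inj.
  apply: (inj_map vI); rewrite map_rev (mapS v u vu) (mapS u v uv).
  exact: (im_rev im uv).
- move=> u v uv; have vI : injective (fun x : S => val x) by apply: val_inj.
  by rewrite -(map_inj_uniq vI) (mapS u v uv); apply: (im_uniq im).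
- by move=> u v w uv; rewrite memS //= (im_br im).
- move=> u v u' v' x uv uv'; rewrite !memS //; exact: (im_disj im).
- move=> x; have /AP [[u xu]|[u [v [uv xi]]]] := valP x.
    by left; exists u; apply: val_inj.
  by right; exists u, v; rewrite memS.
- move=> x y.
  have E u v : adj u v -> infix [:: x; y] (subdivision_path brS inS u v) =
      infix [:: val x; val y] (subdivision_path br inn u v).
    move=> uv; rewrite -(infix_map_inj _ _ val_inj) /subdivision_path /= map_rcons.
    by rewrite mapS.
  have /AP hx := valP x; have /AP hy := valP y.
  have := im_adj im hx hy; rewrite /= /induced_adj => ->.
  by split=> -[u [v [uv h]]]; exists u, v; split=> //; [exact: (eq_ind_r is_true h (E u v uv))|exact: (eq_ind _ is_true h _ (E u v uv))].
Qed.

Definition independent (G : sgraph) (X : {set G}) :=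
  forall x y, x \in X -> y \in X -> ~~ adj x y.

(** The edges of the graph whose 1-subdivision is induced by X and M. *)
Definition linked (G : sgraph) (X M : {set G}) : rel G := fun x y =>
  (x != y) && [exists a in M, nbr adj a :&: X == [set x; y]].

Section Lift.
Variables (G : sgraph) (X M : {set G}).
Hypotheses (indX : independent X) (indM : independent M).

Lemma linked_sym : symmetric (linked X M).
Proof. by move=> x y; rewrite /linked eq_sym setUC. Qed.

Lemma linked_irr : irreflexive (linked X M).
Proof. by move=> x; rewrite /linked eqxx. Qed.

Lemma linked_mem x y : linked X M x y -> x \in X /\ y \in X.
Proof.
case/andP => _ /exists_inP [a _ /eqP /setP E]; split.
  by move: (E x); rewrite set21 inE => /andP [].
by move: (E y); rewrite set22 inE => /andP [].
Qed.

Definition mid (x y : G) : G :=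
  odflt x [pick a | (a \in M) && (nbr adj a :&: X == [set x; y])].

Lemma midP x y : linked X M x y ->
  mid x y \in M /\ nbr adj (mid x y) :&: X = [set x; y].
Proof.
case/andP => _ /exists_inP [a Ma Ea]; rewrite /mid; case: pickP => [b /andP [? /eqP]|] //=.
by move/(_ a); rewrite Ma Ea.
Qed.

Lemma midC x y : linked X M x y -> mid x y = mid y x.
Proof.
case/andP => _ /exists_inP [a Ma Ea]; rewrite /mid [[set y; x]]setUC.
by case: pickP => //= /(_ a); rewrite Ma Ea.
Qed.

Lemma adj_mid x y z : linked X M x y -> z \in X ->
  adj (mid x y) z = (z == x) || (z == y).
Proof.
move=> /midP [_ /setP /(_ z)]; rewrite !inE => E Xz; by rewrite Xz andbT in E.
Qed.

Lemma mid_notinX x y : linked X M x y -> mid x y \notin X.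
Proof.
move=> l; apply/negP => Xm; have [Xx _] := linked_mem l.
by have := indX Xm Xx; rewrite adj_mid // eqxx.
Qed.

Lemma mid_eq x y a b : linked X M x y -> linked X M a b -> mid x y = mid a b ->
  [set x; y] = [set a; b].
Proof. by move=> /midP [_ <-] /midP [_ <-] ->. Qed.

(** The inner vertices of the path that results from subdividing every edge of
    the path x, p, y once. *)
Fixpoint interleave x p y :=
  if p is z :: p' then mid x z :: z :: interleave z p' y else [:: mid x y].

Lemma interleave_rcons x p z y :
  interleave x (rcons p z) y = interleave x p z ++ [:: z; mid z y].
Proof. by elim: p x => //= a p IH x; rewrite IH. Qed.

Lemma rev_interleave x p y : path (linked X M) x (rcons p y) ->
  rev (interleave x p y) = interleave y (rev p) x.
Proof.
elim: p x => [|z p IH] x /=; first by rewrite andbT => /midC ->.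
case/andP => lxz pth; rewrite !rev_cons IH // interleave_rcons.
by rewrite -!cats1 -catA /= midC.
Qed.

Lemma infix2_cons (T : eqType) (a b x : T) s :
  infix [:: a; b] (x :: s) = ((a == x) && (ohead s == Some b)) || infix [:: a; b] s.
Proof.
case: s => [|y s]; rewrite infix_consl; first by rewrite prefix_cons andbC.
by rewrite !prefix_cons prefix0s andbT [b == y]eq_sym.
Qed.

Lemma infix2_nil (T : eqType) (a b : T) : infix [:: a; b] [::] = false.
Proof. by []. Qed.

Lemma infix2_interleave x p y z w : path (linked X M) x (rcons p y) ->
  infix [:: z; w] (x :: rcons (interleave x p y) y) ->
  exists a b, [/\ linked X M a b, infix [:: a; b] (x :: rcons p y) &
    (z = a /\ w = mid a b) \/ (z = mid a b /\ w = b)].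
Proof.
elim: p x => [|c p IH] x /=.
  rewrite andbT => l; rewrite !infix2_cons infix2_nil /= !andbF !orbF.
  case/orP => /andP [/eqP -> /eqP [<-]]; exists x, y; split=> //; rewrite ?infix2_cons ?eqxx //; [left|right]; by [].
case/andP => l pth; rewrite infix2_cons /= => /orP [/andP [/eqP -> /eqP [<-]]|].
  by exists x, c; split=> //; [rewrite infix2_cons /= !eqxx|left].
rewrite infix2_cons /= => /orP [/andP [/eqP -> /eqP [<-]]|].
  by exists x, c; split=> //; [rewrite infix2_cons /= !eqxx|right].
move=> /(IH _ pth) [a [b [lab inf h]]]; exists a, b; split=> //.
by rewrite infix2_cons inf orbT.
Qed.

Lemma interleave_infix2 x p y a b : path (linked X M) x (rcons p y) ->
  infix [:: a; b] (x :: rcons p y) ->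
  [/\ linked X M a b, infix [:: a; mid a b] (x :: rcons (interleave x p y) y) &
   infix [:: mid a b; b] (x :: rcons (interleave x p y) y)].
Proof.
elim: p x => [|c p IH] x /=.
  rewrite andbT => l; rewrite !infix2_cons infix2_nil /= !andbF !orbF => /andP [/eqP -> /eqP [<-]].
  by rewrite !eqxx /= orbT; split.
case/andP => l pth; rewrite infix2_cons /= => /orP [/andP [/eqP -> /eqP [<-]]|].
  by rewrite !(infix2_cons _ _ x) !(infix2_cons _ _ (mid x c)) /= !eqxx /= orbT; split.
move=> /(IH _ pth) [lab i1 i2]; split=> //.
  by rewrite 2!infix2_cons i1 !orbT.
by rewrite 2!infix2_cons i2 !orbT.
Qed.

Lemma mem_interleave x p y z : path (linked X M) x (rcons p y) -> z \in interleave x p y ->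
  z \in p \/ exists a b, [/\ linked X M a b, infix [:: a; b] (x :: rcons p y) & z = mid a b].
Proof.
elim: p x => [|c p IH] x /=.
  rewrite andbT inE => l /eqP ->; right; exists x, y; split=> //.
  by rewrite infix2_cons /= !eqxx.
case/andP => l pth; rewrite !inE => /or3P [/eqP ->|/eqP ->|].
- by right; exists x, c; split=> //; rewrite infix2_cons /= !eqxx.
- by left; rewrite eqxx.
case/(IH _ pth) => [->|[a [b [lab i e]]]]; first by left; rewrite orbT.
by right; exists a, b; split=> //; rewrite infix2_cons i orbT.
Qed.

Lemma infix2_mem (T : eqType) (a b : T) s : infix [:: a; b] s -> a \in s /\ b \in s.
Proof.
by move/infixP => [s1 [s2 ->]]; rewrite !mem_cat !inE !eqxx !orbT.
Qed.

(** A subdivision vertex determines the edge that it subdivides, as the set of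
    its neighbours in X; and a path without repetitions uses no edge twice. *)
Lemma uniq_interleave x p y : path (linked X M) x (rcons p y) -> uniq (x :: rcons p y) ->
  {subset p <= X} -> uniq (interleave x p y).
Proof.
elim: p x => [|c p IH] x //; rewrite [rcons _ _]/= [path _ _ _]/= => /andP [l pth].
rewrite cons_uniq => /andP [xn un] sX.
have sX' : {subset p <= X} by move=> z zp; apply: sX; rewrite inE zp orbT.
have Xc : c \in X by apply: sX; rewrite mem_head.
rewrite /= inE negb_or IH // andbT -andbA; apply/and3P; split.
- by apply: contraNneq (mid_notinX l) => ->.
- apply/negP => /(mem_interleave pth) [/sX' Xm|[a [b [lab i e]]]].
    by have := mid_notinX l; rewrite Xm.
  have [ai bi] := infix2_mem i.
  have : x \in [set a; b] by rewrite -(mid_eq l lab e) set21.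
  by rewrite !inE => /orP [/eqP E|/eqP E]; rewrite E ?ai ?bi in xn.
- apply/negP => /(mem_interleave pth) [cp|[a [b [lab i e]]]].
    by move: un; rewrite cons_uniq mem_rcons inE cp orbT.
  by have := mid_notinX lab; rewrite -e Xc.
Qed.

End Lift.

Definition dense_linkage (D : nat) (G : sgraph) : Prop :=
  exists X M : {set G}, [/\ X != set0, independent X, independent M &
    D * #|X| <= edge_count (linked X M) X X].

(** A subdivision of H in the graph of linked pairs becomes induced in G when
    each of its edges is replaced by a path through a vertex of M: X and M are
    independent, and a vertex of M has only two neighbours in X, both next to
    it on the path. *)
Theorem dense_linkage_subdivision (H : sgraph) :
  exists D, forall G, dense_linkage D G -> contains_induced_subdivision G H.
Proof.
(* Each edge of H is listed once, directed by an arbitrary numbering. *)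
pose idx (h : H) := index h (enum H).
pose es := [seq uv <- enum [set: H * H] | adj uv.1 uv.2 && (idx uv.1 < idx uv.2)].
have mes u v : ((u, v) \in es) = adj u v && (idx u < idx v).
  by rewrite mem_filter mem_enum in_setT andbT.
have [|D HD] := @dense_topo_model H es; first by rewrite filter_uniq ?enum_uniq.
exists D => G [X [M [X0 indX indM den]]].
have [br [P tm]] := HD _ _ _ (@linked_sym _ X M) (@linked_irr _ X M) X0 den.
pose Q u v := if (u, v) \in es then P (u, v) else rev (P (v, u)).
have idxI : injective idx.
  by move=> u v E; rewrite -[u](nth_index u (s := enum H)) ?mem_enum // -/(idx u) E nth_index ?mem_enum.
have anti u v : (u, v) \in es -> (v, u) \notin es.
  by rewrite !mes => /andP [_ lt]; rewrite negb_and -leqNgt (ltnW lt) orbT.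
have Qcase u v : adj u v -> ((u, v) \in es /\ Q u v = P (u, v)) \/
    [/\ (v, u) \in es & Q u v = rev (P (v, u))].
  move=> uv; have [lt|gt|E] := ltngtP (idx u) (idx v).
  - by left; rewrite /Q mes uv lt.
  - have vu : (v, u) \in es by rewrite mes gt adj_sym uv.
    by right; rewrite /Q (negbTE (anti _ _ vu)).
  - by move: uv; rewrite (idxI _ _ E) adj_irrefl.
have Qrev u v : adj u v -> Q v u = rev (Q u v).
  move=> uv; have [[h ->]|[h ->]] := Qcase _ _ uv.
    by rewrite /Q (negbTE (anti _ _ h)).
  by rewrite revK /Q h.
have Qpath u v : adj u v -> path (linked X M) (br u) (rcons (Q u v) (br v)).
  move=> uv; have [[h ->]|[h ->]] := Qcase _ _ uv; first exact: (topo_path tm h).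
  have := rev_path (linked X M) (br v) (rcons (P (v, u)) (br u)).
  rewrite last_rcons belast_rcons rev_cons => ->.
  rewrite (eq_path (e' := linked X M)) ?(topo_path tm h) // => x y.
  by rewrite linked_sym.
have Qmem u v : adj u v -> exists2 uv, uv \in es & Q u v =i P uv /\ [set uv.1; uv.2] = [set u; v].
  move=> uv; have [[h ->]|[h ->]] := Qcase _ _ uv.
    by exists (u, v).
  by exists (v, u) => //; split; [move=> x; rewrite mem_rev|rewrite setUC].
have Qsub u v : adj u v -> {subset Q u v <= X}.
  by move=> /Qmem [uv h [E _]] x; rewrite E; apply: (topo_sub tm h).
have Quniq u v : adj u v -> uniq (Q u v).
  move=> uv; have [[h ->]|[h ->]] := Qcase _ _ uv; rewrite ?rev_uniq; exact: (topo_uniq tm h).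
have Qbr u v w : adj u v -> br w \notin Q u v.
  by move=> /Qmem [uv h [E _]]; rewrite E; apply: (topo_avoid tm).
have Qdisj u v u' v' x : adj u v -> adj u' v' -> x \in Q u v -> x \in Q u' v' ->
    [set u; v] = [set u'; v'].
  move=> /Qmem [a ha [Ea <-]] /Qmem [b hb [Eb <-]]; rewrite Ea Eb => xa xb.
  by rewrite (topo_disj tm ha hb xa xb).
have Qne u v : adj u v -> Q u v != [::].
  move=> /Qmem [a ha [Ea _]]; have := topo_nonempty tm ha.
  by case: (P a) Ea => // x s /(_ x); rewrite mem_head; case: (Q u v).
have Quniq' u v : adj u v -> uniq (br u :: rcons (Q u v) (br v)).
  move=> uv; rewrite cons_uniq mem_rcons inE negb_or rcons_uniq !Qbr // Quniq //= !andbT.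
  by apply/eqP => /(topo_inj tm) E; rewrite E adj_irrefl in uv.
pose inn u v := interleave X M (br u) (Q u v) (br v).
have innM u v z : adj u v -> z \in inn u v -> z \in Q u v \/
    exists a b, [/\ linked X M a b, infix [:: a; b] (br u :: rcons (Q u v) (br v)) & z = mid X M a b].
  by move=> uv; apply: mem_interleave; apply: Qpath.
have infix_inner u v a b : adj u v -> infix [:: a; b] (br u :: rcons (Q u v) (br v)) ->
    a \in Q u v \/ b \in Q u v.
  move=> uv; have := Qne _ _ uv; case: (Q u v) => //= x s _.
  rewrite infix2_cons /= => /orP [/andP [_ /eqP [<-]]|]; first by right; rewrite mem_head.
  elim: s x => [|y s IH] x /=.
    rewrite !infix2_cons infix2_nil /= andbF !orbF => /andP [/eqP -> _].
    by left; rewrite mem_head.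
  rewrite infix2_cons => /orP [/andP [/eqP -> _]|/IH [h|h]]; first by left; rewrite mem_head.
    by left; rewrite inE h orbT.
  by right; rewrite inE h orbT.
have midnX a b : linked X M a b -> mid X M a b \notin X by apply: mid_notinX.
have back u v z w : adj u v -> infix [:: z; w] (subdivision_path br inn u v) ->
    infix [:: w; z] (subdivision_path br inn v u).
  move=> uv; rewrite -infix_rev /subdivision_path /inn (Qrev u v uv) -(rev_interleave (Qpath _ _ uv)).
  by rewrite [rev (br u :: _)]rev_cons rev_rcons rcons_cons.
have adjl a b : linked X M a b -> adj a (mid X M a b) /\ adj (mid X M a b) b.
  move=> l; have [Xa Xb] := linked_mem l.
  by rewrite adj_sym !(adj_mid l) // !eqxx orbT.
have vert x : (exists u, x = br u) \/ (exists u v, adj u v /\ x \in inn u v) ->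
    x \in X \/ exists u v a b, [/\ adj u v, linked X M a b,
      infix [:: a; b] (br u :: rcons (Q u v) (br v)) & x = mid X M a b].
  case=> [[u ->]|[u [v [uv xi]]]]; first by left; exact: topo_br tm _.
  have [xq|[a [b [l i e]]]] := innM _ _ _ uv xi; first by left; apply: Qsub xq.
  by right; exists u, v, a, b.
have midadj u v a b z : adj u v -> linked X M a b ->
    infix [:: a; b] (br u :: rcons (Q u v) (br v)) -> z \in X -> adj (mid X M a b) z ->
    exists u' v', adj u' v' /\ infix [:: mid X M a b; z] (subdivision_path br inn u' v').
  move=> uv l i Xz; rewrite (adj_mid l) //.
  have [_ i1 i2] := interleave_infix2 (Qpath _ _ uv) i.
  case/orP => /eqP ->; last by exists u, v.
  by exists v, u; split; [rewrite adj_sym|apply: back].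
apply: (@induced_model_contains G H br inn); split.
- exact: topo_inj tm.
- by move=> u v uv; rewrite /inn Qrev // rev_interleave // Qpath.
- move=> u v uv; apply: (uniq_interleave indX (Qpath _ _ uv)); [exact: Quniq'|exact: Qsub].
- move=> u v w uv; apply/negP => /(innM _ _ _ uv) [|[a [b [l _ e]]]].
    by apply/negP; apply: Qbr.
  by have := midnX _ _ l; rewrite -e (topo_br tm w).
- move=> u v u' v' x uv uv' /(innM _ _ _ uv) [xQ|[a [b [l i e]]]]
    /(innM _ _ _ uv') [xQ'|[a' [b' [l' i' e']]]].
  + exact: Qdisj xQ xQ'.
  + by have := midnX _ _ l'; rewrite -e' (Qsub _ _ uv _ xQ).
  + by have := midnX _ _ l; rewrite -e (Qsub _ _ uv' _ xQ').
  + have E : [set a; b] = [set a'; b'] by apply: (mid_eq l l'); rewrite -e.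
    have shared c : c \in Q u v -> c \in [set a; b] -> [set u; v] = [set u'; v'].
      rewrite E => cQ cab; have [a'i b'i] := infix2_mem i'.
      have : c \in br u' :: rcons (Q u' v') (br v').
        by move: cab; rewrite !inE => /orP [/eqP ->|/eqP ->].
      rewrite inE mem_rcons inE => /or3P [/eqP ec|/eqP ec|cQ'].
      * by have := Qbr u v u' uv; rewrite -ec cQ.
      * by have := Qbr u v v' uv; rewrite -ec cQ.
      * exact: Qdisj cQ cQ'.
    by have [h|h] := infix_inner _ _ _ _ uv i; apply: (shared _ h); rewrite ?set21 ?set22.
- move=> x y hx hy; split; last first.
    move=> [u [v [uv i]]].
    have [a [b [l _ [[-> ->]|[-> ->]]]]] := infix2_interleave (Qpath _ _ uv) i.
      by have [] := adjl _ _ l.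
    by have [] := adjl _ _ l.
  have [Xx|[u [v [a [b [uv l i ->]]]]]] := vert _ hx;
  have [Xy|[u' [v' [a' [b' [uv' l' i' ->]]]]]] := vert _ hy.
  + by rewrite (negbTE (indX _ _ Xx Xy)).
  + rewrite adj_sym => /(midadj _ _ _ _ _ uv' l' i' Xx) [w [w' [ww h]]].
    by exists w', w; split; [rewrite adj_sym|apply: back].
  + by move=> axy; apply: (midadj _ _ _ _ _ uv l i Xy axy).
  + have [h _] := midP l; have [h' _] := midP l'.
    by rewrite (negbTE (indM _ _ h h')).
Qed.

(** * Sparse graphs and dense pairs of sets *)

Notation nb := (nbr adj).

(** All that is used of sparseness.  It holds with 1/q at most c, because e(T, W)
    would exceed (1 - 1/q)|T||W| if every x in T failed. *)
Definition nonadjacency_rich (q t : nat) (G : sgraph) : Prop :=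
  forall W T : {set G}, t <= #|W| -> t <= #|T| ->
    exists2 x, x \in T & #|W| <= q * #|W :\: nb x|.

Section Sparse.
Local Open Scope ring_scope.

Lemma edges_betweenE (G : sgraph) (A B : {set G}) :
  edges_between A B = edge_count adj A B.
Proof.
rewrite edge_countE /edges_between card_setsum pair_big_dep /=.
by apply: eq_bigl => -[x y]; rewrite in_setX.
Qed.

Lemma sparse_rich (R : realType) (c : R) (q t : nat) (G : sgraph) :
  (0 < t)%N -> 1 <= c * q%:R -> sparse c t G -> nonadjacency_rich q t G.
Proof.
move=> t0 cq sp W T tW tT.
have [/exists_inP [x Tx h]|] := boolP [exists x in T, (#|W| <= q * #|W :\: nb x|)%N].
  by exists x.
rewrite negb_exists_in => /forall_inP H; exfalso.
have lower : (q * (#|T| * #|W|) + #|T| <= q * edge_count adj T W + #|T| * #|W|)%N.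
  rewrite -!sum_nat_const /edge_count !big_distrr /= -[X in (_ + X <= _)%N]sum1_card -!big_split /=.
  apply: leq_sum => x Tx; have := H x Tx; rewrite -ltnNge -(cardsID (nb x) W) [W :&: _]setIC.
  by rewrite mulnDr; lia.
have T0 : (0 < #|T|)%N by apply: leq_trans tT.
have := sp T W tT tW; rewrite edges_betweenE.
have : (q%:R * (#|T|%:R * #|W|%:R) + #|T|%:R <=
        q%:R * (edge_count adj T W)%:R + #|T|%:R * #|W|%:R :> R).
  by rewrite -!natrM -!natrD ler_nat.
have : 0 < #|T|%:R :> R by rewrite ltr0n.
have : 0 <= #|W|%:R :> R by [].
have : 0 <= q%:R :> R by [].
set T' := #|T|%:R; set W' := #|W|%:R; set q' := q%:R in cq *; set E := _%:R.
move=> q0 W0 T0' h1 h2.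
have h3 : q' * E <= q' * ((1 - c) * T' * W') by rewrite ler_wpM2l.
have h4 : 0 <= (c * q' - 1) * (T' * W') by rewrite mulr_ge0 ?subr_ge0 // mulr_ge0 // ltW.
lra.
Qed.
End Sparse.

Section Rich.
Variables (G : sgraph) (q t : nat).
Hypotheses (rich : nonadjacency_rich q t G) (q0 : 0 < q) (t0 : 0 < t).

(** This is why greedy choices work: a choice among many more than t candidates is
    hardly affected by a constant number of such requirements. *)
Lemma card_mostly_adjacent_le (W T : {set G}) : t <= #|W| ->
  #|[set x in T | q * #|W :\: nb x| < #|W|]| <= t.
Proof.
move=> tW; rewrite leqNgt; apply/negP => /ltnW lt.
have [x] := rich tW lt; rewrite inE => /andP [_ h1] h2.
by rewrite ltnNge h2 in h1.
Qed.

Lemma avoid_small_sets (T : finType) (J : eqType) (r : seq J) (B : J -> {set T})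
    (S : {set T}) k : (forall j, j \in r -> #|B j| <= k) -> size r * k < #|S| ->
  exists2 x, x \in S & forall j, j \in r -> x \notin B j.
Proof.
elim: r S => [|j r IH] S hB.
  by rewrite card_gt0 => /set0Pn [x Sx]; exists x.
rewrite /= mulSn => hS.
have [||x] := IH (S :\: B j).
- by move=> i ir; apply: hB; rewrite inE ir orbT.
- rewrite cardsD ltn_subRL; apply: leq_ltn_trans hS.
  by rewrite leq_add2r; apply: leq_trans (hB j (mem_head _ _)); rewrite subset_leq_card ?subsetIr.
rewrite inE => /andP [nB Sx] hx; exists x => // i; rewrite inE => /orP [/eqP ->//|]; exact: hx.
Qed.

(** One step of the greedy choice below leaves a 1/q proportion of each of the
    other sets, and has to avoid at most t vertices for each of them. *)
Fixpoint transversal_size n := if n is m.+1 then q * transversal_size m + n else 1.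

(** Greedy choice: pick a vertex of the first set that leaves a positive
    proportion of nonneighbours in each of the others, and continue in these. *)
Lemma independent_transversal (x0 : G) (I : eqType) (r : seq I) (W : I -> {set G}) :
  (forall i, i \in r -> transversal_size (size r) * t <= #|W i|) ->
  exists f : I -> G, (forall i, i \in r -> f i \in W i) /\
    forall i j, i \in r -> j \in r -> ~~ adj (f i) (f j).
Proof.
elim: r W => [|i r IH] W hW; first by exists (fun=> x0).
pose B j := [set x in W i | q * #|W j :\: nb x| < #|W j|].
have hW' j : j \in i :: r -> [/\ t <= #|W j|, (size r).+1 * t <= #|W j| &
    q * (transversal_size (size r) * t) <= #|W j|].
  move=> jr; have := hW j jr; rewrite /= mulnDl => h; split; apply: leq_trans h.
  - by rewrite mulSn addnCA leq_addr.
  - by rewrite leq_addl.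
  - by rewrite mulnA leq_addr.
have [||x Wx hx] := @avoid_small_sets _ _ r B (W i) t.
- by move=> j jr; apply: card_mostly_adjacent_le; have [] := hW' j; rewrite ?inE ?jr ?orbT.
- have [_ h _] := hW' i (mem_head _ _); apply: leq_trans h.
  by rewrite mulSn -[ltnLHS]add0n ltn_add2r.
have [|f [fW fI]] := IH (fun j => W j :\: nb x).
  move=> j jr; have jr' : j \in i :: r by rewrite inE jr orbT.
  have [_ _ h] := hW' j jr'; have := hx j jr; rewrite inE Wx /= -leqNgt => h'.
  by rewrite -(leq_pmul2l q0); apply: leq_trans h h'.
have nx j : j \in r -> ~~ adj x (f j) by move=> /fW; rewrite !inE => /andP [].
exists (fun j => if j == i then x else f j); split=> [j|j k].
  rewrite inE; case: eqP => [-> //|_ /= /fW]; by rewrite inE => /andP [].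
rewrite !inE; case: eqP => _ /=; case: eqP => _ /=.
- by rewrite adj_irrefl.
- by move=> _; apply: nx.
- by move=> jr _; rewrite adj_sym; apply: nx.
- exact: fI.
Qed.

(** Sums over S^n, with the head of the sequence summed first, as needed for
    choosing the entries one by one. *)
Fixpoint seq_sum (T : finType) (S : {set T}) n (F : seq T -> nat) : nat :=
  if n is m.+1 then \sum_(x in S) seq_sum S m (fun s => F (x :: s)) else F [::].

Lemma seq_sumS (T : finType) (S : {set T}) n F :
  seq_sum S n.+1 F = \sum_(x in S) seq_sum S n (fun s => F (x :: s)).
Proof. by []. Qed.

Lemma leq_seq_sum (T : finType) (S S' : {set T}) n (F F' : seq T -> nat) :
  S \subset S' ->
  (forall s, size s = n -> all (mem S) s -> F s <= F' s) ->
  seq_sum S n F <= seq_sum S' n F'.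
Proof.
move=> sS; elim: n F F' => [|n IH] F F' h /=; first exact: h.
rewrite (bigID (mem S) (mem S')) /= -[leqLHS]addn0 leq_add //.
rewrite [leqRHS](eq_bigl (mem S)) => [|x]; last first.
  by rewrite /= andb_idl // => /(subsetP sS).
apply: leq_sum => x Sx; apply: IH => s sz al; apply: h; first by rewrite /= sz.
by rewrite /= al andbT.
Qed.

Lemma seq_sum_const (T : finType) (S : {set T}) n k :
  seq_sum S n (fun=> k) = k * #|S| ^ n.
Proof.
elim: n => [|n IH] /=; first by rewrite muln1.
by rewrite IH sum_nat_const expnS mulnCA.
Qed.

Lemma exchange_seq_sum (T : finType) (J : Type) (r : seq J) (P : pred J) (S : {set T}) n
    (F : J -> seq T -> nat) :
  \sum_(j <- r | P j) seq_sum S n (F j) = seq_sum S n (fun s => \sum_(j <- r | P j) F j s).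
Proof.
elim: n F => [|n IH] F //=; rewrite exchange_big /=; apply: eq_bigr => x _.
by rewrite IH.
Qed.

Lemma seq_sum_fiber (T : finType) (S : {set T}) i m (F : seq T -> nat) k :
  (forall u v, size u = i -> size v = m -> all (mem S) u -> all (mem S) v ->
     \sum_(x in S) F (u ++ x :: v) <= k) ->
  seq_sum S (i + m).+1 F <= k * #|S| ^ (i + m).
Proof.
elim: i F => [|i IH] F h.
  rewrite add0n /= exchange_seq_sum -seq_sum_const; apply: leq_seq_sum => // s sz al.
  exact: (h [::]).
rewrite addSn seq_sumS expnS mulnCA -sum_nat_const; apply: leq_sum => y Sy.
apply: IH => u v su sv au av; apply: (h (y :: u)) => //=; first by rewrite su.
by rewrite au andbT.
Qed.

(** The sum over one position can be taken first, because sums over the other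
    positions commute with it. *)
Lemma seq_sum_position (T : finType) (S : {set T}) i n (F : seq T -> nat) k :
  i < n ->
  (forall u v, size u = i -> size (u ++ v) = n.-1 -> all (mem S) u -> all (mem S) v ->
     \sum_(x in S) F (u ++ x :: v) <= k) ->
  seq_sum S n F <= k * #|S| ^ n.-1.
Proof.
move=> lt h; have E : n = (i + (n.-1 - i)).+1 by lia.
rewrite E; apply: seq_sum_fiber => u v su sv; apply: h => //.
by rewrite size_cat; lia.
Qed.

(** The inverse of the proportion of sequences in S^n that can be prescribed to
    be bad in [independent_sequence]. *)
Fixpoint supersaturation n := if n is m.+1 then 2 * (2 * q) ^ n * supersaturation m else 1.

Lemma supersaturation_gt0 n : 0 < supersaturation n.
Proof. by elim: n => //= n IH; rewrite !muln_gt0 IH expn_gt0 muln_gt0 q0. Qed.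

(** Independent sequences have positive density in S^n, so that a sparse enough
    family P of sequences cannot contain all of them.  The first entry is
    chosen with at most twice the average number of bad completions and with a
    1/q proportion of nonneighbours; in these, bad completions still have small
    density. *)
Lemma independent_sequence n (S : {set G}) (P : seq G -> bool) :
  supersaturation n * t <= #|S| -> supersaturation n * seq_sum S n P < #|S| ^ n ->
  exists s, [/\ size s = n, all (mem S) s, ~~ P s &
    pairwise (fun x y => ~~ adj x y && (x != y)) s].
Proof.
elim: n S P => [|n IH] S P hS hP.
  by exists [::]; split=> //; move: hP; rewrite /= mul1n expn0; case: (P [::]).
set K := supersaturation n.+1 in hS hP.
have K0 : 0 < K by apply: supersaturation_gt0.
pose c x := seq_sum S n (fun s => P (x :: s)).
pose T := [set x in S | K * c x < 2 * #|S| ^ n].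
have S0 : 0 < #|S| by apply: leq_trans hS; rewrite muln_gt0 K0.
have cT : #|S| <= 2 * #|T|.
  have : #|S :\: T| * (2 * #|S| ^ n) <= #|S| ^ n.+1.
    apply: leq_trans (ltnW hP); rewrite -sum_nat_const big_distrr /=.
    rewrite [leqRHS](bigID (mem T)) /= -[leqLHS]add0n leq_add //.
    rewrite [leqRHS](eq_bigl (mem (S :\: T))) => [|x]; last by rewrite !inE andbC.
    apply: leq_sum => x; rewrite !inE => /andP [h Sx].
    by rewrite Sx /= -leqNgt in h.
  rewrite expnS mulnCA mulnA leq_pmul2r ?expn_gt0 ?S0 //.
  have sTS : T \subset S by apply/subsetP => x; rewrite inE => /andP [].
  rewrite cardsD (setIidPr sTS); have := subset_leq_card sTS; clear; lia.
have tS : t <= #|S| by apply: leq_trans hS; rewrite leq_pmull.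
have KE : K = 2 * (2 * q) ^ n.+1 * supersaturation n by [].
have pw : 0 < (2 * q) ^ n by rewrite expn_gt0 muln_gt0 q0.
have tT : t <= #|T|.
  have : 2 * t <= K * t by rewrite leq_mul2r KE -mulnA leq_pmulr ?orbT // muln_gt0 supersaturation_gt0 expn_gt0 muln_gt0 q0.
  move: cT hS; clear; lia.
have [x Tx hx] := rich tS tT.
move: Tx; rewrite inE => /andP [Sx cx].
pose S' := (S :\: nb x) :\ x.
have big : 2 * q * supersaturation n * t <= #|S|.
  apply: leq_trans hS; rewrite KE leq_mul2r leq_mul2r expnS; apply/orP; right; apply/orP; right.
  by move: pw; clear; move: (_ ^ n) => y; nia.
have hS' : #|S| <= 2 * q * #|S'|.
  have : #|S :\: nb x| <= #|S'|.+1 by rewrite [leqLHS](cardsD1 x) -add1n leq_add2r leq_b1.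
  have : 2 * q <= #|S|.
    by apply: leq_trans big; rewrite -mulnA leq_pmulr // muln_gt0 supersaturation_gt0.
  move: hx; clear; nia.
have [||s [sz al Ps pws]] := IH S' (fun s => P (x :: s)).
- by move: big hS' q0; clear; move: (supersaturation n) => k; nia.
- have sS : S' \subset S.
    by apply: subset_trans (subsetDl _ _) (subsetDl _ _).
  have le1 : seq_sum S' n (fun s => P (x :: s)) <= c x by apply: leq_seq_sum.
  have le2 : #|S| ^ n <= (2 * q) ^ n * #|S'| ^ n.
    by rewrite -expnMn; case: (posnP n) => [-> //|n0]; rewrite leq_exp2r.
  have lt3 : (2 * q) ^ n * (2 * q * supersaturation n * c x) < (2 * q) ^ n * #|S'| ^ n.
    apply: leq_trans le2; move: cx; rewrite KE expnS.
    have -> : 2 * (2 * q * (2 * q) ^ n) * supersaturation n * c x =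
      2 * ((2 * q) ^ n * (2 * q * supersaturation n * c x)) by ring.
    by rewrite ltn_pmul2l.
  rewrite ltn_pmul2l // in lt3; apply: leq_ltn_trans lt3.
  by apply: leq_mul => //; rewrite leq_pmull // muln_gt0 q0.
have alx y : y \in s -> [/\ y != x, ~~ adj x y & y \in S].
  by move=> /(allP al); rewrite /= !inE => /and3P.
exists (x :: s); split.
- by rewrite /= sz.
- by rewrite /= Sx; apply/allP => y /alx [].
- exact: Ps.
- rewrite pairwise_cons pws andbT; apply/allP => y /alx [nyx nxy _].
  by rewrite nxy eq_sym.
Qed.

Definition codegree (A : {set G}) (x y : G) := #|[set a in A | adj a x && adj a y]|.

Lemma sum_setI (T : finType) (N B : {set T}) (F : T -> nat) :
  \sum_(x in N :&: B) F x = \sum_(x in B) (x \in N) * F x.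
Proof.
rewrite big_mkcond [RHS]big_mkcond /=; apply: eq_bigr => x _; rewrite inE.
by case: (x \in B); case: (x \in N); rewrite ?mul1n ?mul0n.
Qed.

Lemma sum_pairs_common_nbr (A B : {set G}) (f : G -> G -> nat) :
  \sum_(a in A) \sum_(x in nb a :&: B) \sum_(y in nb a :&: B) f x y =
  \sum_(x in B) \sum_(y in B) f x y * codegree A x y.
Proof.
under eq_bigr => a _.
  rewrite sum_setI; under eq_bigr => x _ do rewrite sum_setI big_distrr /=.
  over.
rewrite exchange_big /=; apply: eq_bigr => x _.
rewrite exchange_big /=; apply: eq_bigr => y _.
rewrite /codegree card_setsum big_distrr /=; apply: eq_bigr => a _.
by rewrite !inE mulnA mulnb mulnC.
Qed.

(** Dependent random choice with a single vertex: two vertices with few common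
    neighbours in A are seldom both in the neighbourhood of a random a, while
    that neighbourhood is large on average. *)
Lemma dense_start (z w k : nat) (A B : {set G}) :
  0 < #|A| -> 0 < #|B| -> 4 * z ^ 2 * k <= w -> 0 < z ->
  #|A| * #|B| <= z * edge_count adj A B ->
  exists2 a, a \in A & #|B| <= 2 * z * #|nb a :&: B| /\
    k * (\sum_(x in nb a :&: B) \sum_(y in nb a :&: B) (w * codegree A x y < #|A|))
      <= #|nb a :&: B| ^ 2.
Proof.
move=> A0 B0 kw z0 dens.
pose d a := #|nb a :&: B|.
pose bad a := \sum_(x in nb a :&: B) \sum_(y in nb a :&: B) (w * codegree A x y < #|A|).
have [/exists_inP [a Aa /andP [h1 h2]]|] :=
  boolP [exists a in A, (#|B| <= 2 * z * d a) && (k * bad a <= d a ^ 2)].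
  by exists a.
rewrite negb_exists_in => /forall_inP H; exfalso.
have pt a : a \in A -> 4 * z ^ 2 * d a ^ 2 + 1 <= #|B| ^ 2 + 4 * z ^ 2 * k * bad a.
  move=> /H; rewrite negb_and -!ltnNge addn1 => /orP [h|h].
    rewrite ltn_addr // (_ : 4 * z ^ 2 * d a ^ 2 = (2 * z * d a) ^ 2) ?ltn_sqr //.
    by rewrite !expnMn.
  rewrite ltn_addl // -[4 * _ * k * _]mulnA ltn_pmul2l // muln_gt0 expn_gt0 z0 //.
have low a : 2 * z * d a * #|B| <= z ^ 2 * d a ^ 2 + #|B| ^ 2.
  by rewrite -expnMn -[2 * z * _]mulnA -mulnA; exact: nat_Cauchy.
have sbad : w * (\sum_(a in A) bad a) <= #|A| * #|B| ^ 2.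
  rewrite sum_pairs_common_nbr big_distrr /= -mulnn mulnA [#|A| * _]mulnC -[#|B| * _ * _]mulnA -sum_nat_const.
  apply: leq_sum => x _; rewrite big_distrr /= [#|A| * _]mulnC -sum_nat_const; apply: leq_sum => y _.
  by case: ltnP => [/ltnW|_]; rewrite ?mul1n ?mul0n ?muln0.
have S1 : 4 * z ^ 2 * (\sum_(a in A) d a ^ 2) + #|A| <=
    #|A| * #|B| ^ 2 + 4 * z ^ 2 * k * \sum_(a in A) bad a.
  rewrite -sum_nat_const !big_distrr /= -[X in _ + X <= _]sum1_card -!big_split /=.
  exact: leq_sum.
(* Summing [low], this replaces the Cauchy-Schwarz inequality. *)
have S2 : 2 * z * (edge_count adj A B) * #|B| <=
    z ^ 2 * (\sum_(a in A) d a ^ 2) + #|A| * #|B| ^ 2.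
  rewrite -sum_nat_const /edge_count !big_distrr /= big_distrl /= -big_split /=.
  by apply: leq_sum => a _; exact: low.
have S3 : 4 * z ^ 2 * k * (\sum_(a in A) bad a) <= w * (\sum_(a in A) bad a).
  by rewrite leq_mul2r kw orbT.
move: S1 S2 S3 sbad dens A0; move: (\sum_(a in A) _) (\sum_(a in A) _) => s1 s2.
move: (edge_count _ _ _) => E; clear; move: #|A| #|B| => a b S1 S2 S3 sb dens a0.
have : 2 * (a * b) * b <= 2 * (z * E) * b by rewrite leq_mul2r leq_mul2l dens !orbT.
move: S1 S2 S3 sb a0; rewrite expnS expn1; nia.
Qed.

Lemma transversal_size_gt0 n : 0 < transversal_size n.
Proof. by case: n => //= n; rewrite addnS. Qed.

Lemma nth_insert (T : Type) (x0 y x : T) u v i : i != size u ->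
  nth x0 (u ++ x :: v) i = nth x0 (u ++ y :: v) i.
Proof.
move=> h; rewrite !nth_cat; case: ltnP => // le.
by have -> : i - size u = (i - (size u).+1).+1 by move: h le => /eqP; lia.
Qed.

Lemma nth_middle (T : Type) (x0 x : T) u v : nth x0 (u ++ x :: v) (size u) = x.
Proof. by rewrite nth_cat ltnn subnn. Qed.

(** The candidates for the vertex that links the entries i and j of s, when only
    the first k entries have to be avoided. *)
Definition common_only (A : {set G}) (x0 : G) (s : seq G) i j k : {set G} :=
  [set a in A | [&& adj a (nth x0 s i), adj a (nth x0 s j) &
    all (fun l => [|| l == i, l == j | ~~ adj a (nth x0 s l)]) (iota 0 k)]].

Lemma common_only_insert (A : {set G}) x0 u v x i j : i != size u -> j != size u ->
  common_only A x0 (u ++ x :: v) i j (size u) =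
  common_only A x0 (u ++ x0 :: v) i j (size u).
Proof.
move=> hi hj; apply/setP => a; rewrite !inE !(nth_insert x0 x0 x) //.
congr [&& _, _, _ & _]; apply: eq_in_all => l; rewrite mem_iota => /andP [_ lt].
by rewrite (nth_insert x0 x0 x) // neq_ltn lt.
Qed.

(** Each further entry of the sequence that has to be avoided costs a factor
    q. *)
Lemma common_only_size (w N i j : nat) (A : {set G}) x0 s :
  0 < w -> w * q ^ N * t <= #|A| ->
  #|A| <= w * codegree A (nth x0 s i) (nth x0 s j) ->
  (forall k, k < N -> k != i -> k != j -> t <= #|common_only A x0 s i j k| ->
     #|common_only A x0 s i j k| <=
     q * #|common_only A x0 s i j k :\: nb (nth x0 s k)|) ->
  #|A| <= w * q ^ N * #|common_only A x0 s i j N|.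
Proof.
move=> w0 hA cod step.
suff: forall k, k <= N -> #|A| <= w * q ^ k * #|common_only A x0 s i j k|.
  by apply.
elim=> [_|k IH lt].
  rewrite muln1; apply: leq_trans cod _; rewrite leq_mul2l; apply/orP; right.
  by apply: subset_leq_card; apply/subsetP => a; rewrite !inE andbT.
have {}IH := IH (ltnW lt).
have sub : common_only A x0 s i j k.+1 =
    if (k == i) || (k == j) then common_only A x0 s i j k else
    common_only A x0 s i j k :\: nb (nth x0 s k).
  apply/setP => a; rewrite -[k.+1]addn1 /common_only iotaD /=.
  case: ifP => h; rewrite !inE all_cat /= andbT add0n.
    by case/orP: h => ->; rewrite ?orbT andbT.
  move/negbT: h; rewrite negb_or => /andP [/negbTE -> /negbTE ->] /=.
  rewrite [adj (nth _ _ k) a]adj_sym.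
  by case: (adj a (nth x0 s k)); rewrite /= ?andbF ?andbT.
have q1 : w * q ^ k <= w * q ^ k.+1 by rewrite leq_mul2l leq_pexp2l ?orbT.
case: ifP sub => h ->; first by apply: leq_trans IH _; rewrite leq_mul2r q1 orbT.
move/negbT: h; rewrite negb_or => /andP [ki kj].
have tW : t <= #|common_only A x0 s i j k|.
  have wq : 0 < w * q ^ k by rewrite muln_gt0 w0 expn_gt0 q0.
  rewrite -(leq_pmul2l wq); apply: leq_trans IH; apply: leq_trans hA.
  by rewrite leq_mul2r leq_mul2l leq_pexp2l ?(ltnW lt) ?orbT.
apply: leq_trans IH _; rewrite expnSr -!mulnA leq_mul2l leq_mul2l.
by rewrite step ?orbT.
Qed.

Lemma linkage_of_sequence N (A : {set G}) x0 s :
  size s = N -> uniq s -> (forall x y, x \in s -> y \in s -> ~~ adj x y) ->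
  (forall i j, i < N -> j < N -> i != j ->
    transversal_size (N * N) * t <= #|common_only A x0 s i j N|) ->
  0 < N -> dense_linkage N.-1 G.
Proof.
move=> sz us ind W N0.
pose r := [seq ij <- [seq (i, j) | i <- iota 0 N, j <- iota 0 N] | ij.1 < ij.2].
have mr i j : ((i, j) \in r) = (i < j < N).
  rewrite mem_filter; case lt: (i < j) => //=; apply/allpairsP/idP => [[[a b] /=]|jN].
    by rewrite !mem_iota /= add0n => -[_ h [_ ->]].
  by exists (i, j); rewrite !mem_iota /= add0n; split=> //; apply: ltn_trans jN.
have tmono a b : a <= b -> transversal_size a <= transversal_size b.
  move=> /subnK <-; elim: (b - a) => // c IH; apply: leq_trans IH _; rewrite addSn /=.
  by apply: leq_trans (leq_addr _ _); rewrite leq_pmull.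
have [|f [fW fI]] := @independent_transversal x0 _ r (fun ij => common_only A x0 s ij.1 ij.2 N).
  move=> [i j]; rewrite mr => /andP [ij jN] /=.
  apply: leq_trans (W i j _ jN _); last by rewrite neq_ltn ij.
    rewrite leq_mul2r tmono ?orbT // size_filter; apply: leq_trans (count_size _ _) _.
    by rewrite size_allpairs !size_iota.
  exact: ltn_trans jN.
pose X := [set x in s]; pose M := [set x in [seq f ij | ij <- r]].
have XP x : x \in X -> exists2 i, i < N & x = nth x0 s i.
  by rewrite inE => /(nthP x0) [i]; rewrite sz => lt <-; exists i.
have lk i j : i < j -> j < N -> linked X M (nth x0 s i) (nth x0 s j).
  move=> ij jN; have iN := ltn_trans ij jN.
  have ijr : (i, j) \in r by rewrite mr ij.
  apply/andP; split; first by rewrite nth_uniq ?sz // neq_ltn ij.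
  apply/exists_inP; exists (f (i, j)).
    by rewrite inE; apply/mapP; exists (i, j).
  have := fW _ ijr; rewrite inE /= => /and4P [_ ai aj /allP al].
  apply/eqP/setP => x; rewrite !inE; apply/andP/idP.
    case=> ax /(nthP x0) [l]; rewrite sz => lN E.
    have := al l; rewrite mem_iota /= add0n lN => /(_ isT) /or3P [/eqP h|/eqP h|].
    - by rewrite -E h eqxx.
    - by rewrite -E h eqxx orbT.
    - by rewrite E ax.
  by case/orP => /eqP ->; split=> //; rewrite mem_nth ?sz.
exists X, M; split.
- by apply/set0Pn; exists (nth x0 s 0); rewrite inE mem_nth ?sz.
- by move=> x y; rewrite !inE; apply: ind.
- by move=> x y; rewrite !inE => /mapP [a ar ->] /mapP [b br ->]; apply: fI.
have cX : #|X| = N by rewrite cardsE (card_uniqP us).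
rewrite mulnC -sum_nat_const; apply: leq_sum => x Xx.
have := cardsD1 x X; rewrite Xx cX => ->; rewrite add1n /=.
apply: subset_leq_card; apply/subsetP => y; rewrite in_setD1 => /andP [yx Xy].
rewrite inE Xy andbT in_nbr.
have [i iN Ei] := XP _ Xx; have [j jN Ej] := XP _ Xy.
have [ij|ji|E] := ltngtP i j.
- by rewrite Ei Ej lk.
- by rewrite linked_sym Ei Ej lk.
- by rewrite Ei Ej E eqxx in yx.
Qed.

(** The first summand bounds the side on which the linking vertices are chosen,
    the second one the side of the linked vertices. *)
Definition dense_const D z :=
  let N := D.+1 in let K := supersaturation N in
  4 * z ^ 2 * (2 * (8 * K * N ^ 3)) * q ^ N * transversal_size (N * N) +
  4 * z * (K + 5 * K * N ^ 3).

(** In the neighbourhood in B of a suitable a0, almost all pairs have many common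
    neighbours in A.  Almost every sequence of D + 1 vertices there has, for any
    two of its entries, many common neighbours that avoid the other entries: for
    given common neighbours W, at most t choices of a further entry miss less than
    a 1/q proportion of W.  An independent sequence with this property exists by
    supersaturation, and an independent choice of linking vertices by the
    greedy argument. *)
Lemma dense_pair_linkage D z (A B : {set G}) : 0 < z ->
  dense_const D z * t <= #|A| -> dense_const D z * t <= #|B| ->
  #|A| * #|B| <= z * edge_count adj A B -> dense_linkage D G.
Proof.
move=> z0; pose N := D.+1; pose K := supersaturation N.
pose k1 := 8 * K * N ^ 3; pose w := 4 * z ^ 2 * (2 * k1).
have K0 : 0 < K by apply: supersaturation_gt0.
have k10 : 0 < k1 by rewrite /k1 2!muln_gt0 K0 expn_gt0.
have w0 : 0 < w by rewrite /w 3!muln_gt0 expn_gt0 z0 k10.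
pose CA := w * q ^ N * transversal_size (N * N).
pose CB := 4 * z * (K + 5 * K * N ^ 3).
rewrite (_ : dense_const D z = CA + CB) // !mulnDl => hA hB dens.
have {}hA : CA * t <= #|A| by apply: leq_trans hA; rewrite leq_addr.
have {}hB : CB * t <= #|B| by apply: leq_trans hB; rewrite leq_addl.
have A0 : 0 < #|A|.
  by apply: leq_trans hA; rewrite /CA 3!muln_gt0 w0 expn_gt0 q0 transversal_size_gt0.
have B0 : 0 < #|B|.
  by apply: leq_trans hB; rewrite /CB 3!muln_gt0 z0 addn_gt0 K0.
have [a0 _ [h1 h2]] := @dense_start z w (2 * k1) A B A0 B0 (leqnn _) z0 dens.
set S0 := nb a0 :&: B in h1 h2.
pose low x y := w * codegree A x y < #|A|.
pose S1 := [set x in S0 | k1 * #|[set y in S0 | low x y]| <= #|S0|].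
have sS : S1 \subset S0 by apply/subsetP => x; rewrite inE => /andP [].
have S00 : 0 < #|S0| by move: h1 B0; clear; nia.
have cS : #|S0| <= 2 * #|S1|.
  have : #|S0 :\: S1| * #|S0| <= k1 * \sum_(x in S0) \sum_(y in S0) low x y.
    rewrite -sum_nat_const big_distrr /= [leqRHS](bigID (mem S1)) /= -[leqLHS]add0n leq_add //.
    rewrite [leqRHS](eq_bigl (mem (S0 :\: S1))) => [|x]; last by rewrite !inE andbC.
    apply: leq_sum => x; rewrite !inE => /andP [h Sx]; rewrite Sx /= -ltnNge in h.
    by rewrite -(card_setsum S0 (low x)) ltnW.
  move: h2; rewrite -/low cardsD (setIidPr sS) -mulnA.
  have := subset_leq_card sS; move: S00; clear.
  move: (\sum_(x in S0) _) => b s0 le h2 h3.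
  by rewrite expnS expn1 in h2; nia.
have hS1 : (K + 5 * K * N ^ 3) * t <= #|S1|.
  by move: hB h1 cS z0; rewrite /CB; move: (K + _) => c; clear; nia.
have x0 : G by exact: a0.
(* One bad event for each position k: at position j it concerns the pair (i, j)
   itself, at any other position the step that avoids the entry k. *)
pose ev (i j k : nat) s := (i != j) && (if k == i then false else
  if k == j then low (nth x0 s i) (nth x0 s j) else
  (t <= #|common_only A x0 s i j k|) &&
  (q * #|common_only A x0 s i j k :\: nb (nth x0 s k)| < #|common_only A x0 s i j k|)).
pose P s := [exists i : 'I_N, exists j : 'I_N, exists k : 'I_N, ev i j k s].
have evc (i j k : 'I_N) : seq_sum S1 N (ev i j k) <= (t + #|S0| %/ k1) * #|S1| ^ N.-1.
  apply: (seq_sum_position (i := k)) => // u v su sz alu alv.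
  rewrite /ev; have [E|nij] := eqVneq (nat_of_ord i) j.
    by rewrite big1.
  have [Ek|nki] := eqVneq (nat_of_ord k) i; first by rewrite big1.
  have iu : nat_of_ord i != size u by rewrite su eq_sym.
  have [Ek|nkj] := eqVneq (nat_of_ord k) j.
    under eq_bigr => x _ do rewrite (nth_insert x0 x0 x) // -Ek -su nth_middle.
    set y := nth _ _ i; rewrite -(card_setsum S1 (low y)) -[leqLHS]add0n leq_add //.
    have : y \in S1.
      rewrite /y nth_cat; case: ltnP => ltu; first by apply: (allP alu); rewrite mem_nth.
      have lti : i - size u < (size v).+1.
        by move: (ltn_ord i); rewrite size_cat /= in sz; move: sz ltu; rewrite /N; lia.
      have ne : i - size u != 0 by rewrite subn_eq0 -ltnNge ltn_neqAle eq_sym iu.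
      by case: (i - size u) lti ne => // l lti _; apply: (allP alv); rewrite /= mem_nth.
    rewrite inE => /andP [_ h]; rewrite leq_divRL // mulnC; apply: leq_trans h.
    rewrite leq_mul2l; apply/orP; right; apply: subset_leq_card; apply/subsetP => x.
    by rewrite !inE => /andP [/andP [-> _] ->].
  have ju : nat_of_ord j != size u by rewrite su eq_sym.
  under eq_bigr => x _ do rewrite -su (@common_only_insert A x0 u v x i j iu ju) nth_middle.
  set W := common_only _ _ _ _ _ _; case: (leqP t #|W|) => tW; last by rewrite big1.
  rewrite /= -(card_setsum S1 (fun x => q * #|W :\: nb x| < #|W|)).
  by apply: leq_trans (leq_addr _ _); apply: card_mostly_adjacent_le.
have [||s [sz al nP pw]] := @independent_sequence N S1 P.
- by apply: leq_trans hS1; rewrite leq_mul2r leq_addr orbT.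
- have : seq_sum S1 N P <= N ^ 3 * ((t + #|S0| %/ k1) * #|S1| ^ N.-1).
    have -> : N ^ 3 * ((t + #|S0| %/ k1) * #|S1| ^ N.-1) =
       \sum_(i < N) \sum_(j < N) \sum_(k < N) (t + #|S0| %/ k1) * #|S1| ^ N.-1.
      by rewrite !sum_nat_const !card_ord !expnS expn0 muln1 !mulnA.
    apply: (@leq_trans (\sum_(i < N) \sum_(j < N) \sum_(k < N) seq_sum S1 N (ev i j k))).
      rewrite (eq_bigr (fun i : 'I_N => seq_sum S1 N (fun s => \sum_(j < N) \sum_(k < N) ev i j k s))) => [|i _]; last first.
        by rewrite -exchange_seq_sum; apply: eq_bigr => j _; rewrite exchange_seq_sum.
      rewrite exchange_seq_sum; apply: leq_seq_sum => // s _ _.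
      rewrite /P; case: existsP => // -[i /existsP [j /existsP [k h]]].
      by rewrite (bigD1 i) //= (bigD1 j) //= (bigD1 k) //= h.
    by apply: leq_sum => i _; apply: leq_sum => j _; apply: leq_sum => k _.
  move=> le; apply: (@leq_ltn_trans (K * (N ^ 3 * ((t + #|S0| %/ k1) * #|S1| ^ N.-1)))).
    by rewrite leq_mul2l le orbT.
  have -> : #|S1| ^ N = #|S1| * #|S1| ^ N.-1 by rewrite -expnS.
  rewrite (mulnA (N ^ 3)) (mulnA K) ltn_pmul2r; last first.
    by rewrite expn_gt0; apply/orP; left; move: S00 cS; clear; lia.
  have : k1 * (#|S0| %/ k1) <= #|S0| by rewrite mulnC leq_divM.
  move: (#|S0| %/ k1) => d; move: cS hS1 t0 K0; rewrite /k1; clear.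
  have : 0 < N ^ 3 by rewrite expn_gt0.
  move: (N ^ 3) #|S0| #|S1| => n s0 s1; clear; move: K => k'.
  move=> n0 cS hS t0' k0 hd.
  have e1 : 8 * (k' * n * d) <= 2 * s1 by apply: leq_trans cS; rewrite !mulnA.
  have e2 : k' * t + 5 * (k' * n * t) <= s1 by move: hS; rewrite mulnDl !mulnA.
  have e3 : 0 < k' * t by rewrite muln_gt0 k0.
  rewrite mulnA mulnDr; move: (k' * n * d) (k' * n * t) (k' * t) e1 e2 e3 => a b c'; clear; lia.
have nev (i j k : nat) : i < N -> j < N -> k < N -> ~~ ev i j k s.
  move=> iN jN kN; move: nP; rewrite negb_exists => /forallP /(_ (Ordinal iN)).
  by rewrite negb_exists => /forallP /(_ (Ordinal jN)); rewrite negb_exists => /forallP /(_ (Ordinal kN)).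
have us : uniq s.
  by rewrite uniq_pairwise; apply: sub_pairwise pw => x y /andP [].
apply: (@linkage_of_sequence N A x0 s) => // [x y xs ys|i j iN jN ij].
  have [->|xy] := eqVneq x y; first by rewrite adj_irrefl.
  have /(pairwiseP x0) pp := pw.
  move: xs ys => /(nthP x0) [i iN Ei] /(nthP x0) [j jN Ej].
  have [ij|ji|E] := ltngtP i j.
  - by have /andP [] := pp i j iN jN ij; rewrite Ei Ej.
  - by have /andP [] := pp j i jN iN ji; rewrite Ei Ej adj_sym.
  - by rewrite -Ei -Ej E eqxx in xy.
have wq : 0 < w * q ^ N by rewrite muln_gt0 w0 expn_gt0 q0.
rewrite -(leq_pmul2l wq) mulnA; apply: (leq_trans hA).
apply: common_only_size => //.
- apply: leq_trans hA; rewrite /CA leq_mul2r leq_pmulr ?orbT //.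
  exact: transversal_size_gt0.
- by have := nev i j j iN jN jN; rewrite /ev ij eq_sym (negbTE ij) eqxx /= -leqNgt.
- move=> k kN ki kj tW; have := nev i j k iN jN kN.
  by rewrite /ev ij (negbTE ki) (negbTE kj) tW /= -leqNgt.
Qed.

End Rich.

(** * Random sampling *)

(** The last step of both sampling arguments, with cherries (a, b, b') in Q. *)
Lemma linkage_of_cherries (G : sgraph) D (X : {set G}) (Q : {set G * G * G}) :
  D * #|X| < #|Q| -> independent X ->
  (forall a b b', (a, b, b') \in Q -> [/\ b != b', b \in X, b' \in X &
     nb a :&: X = [set b; b']]) ->
  (forall a a' b b', (a, b, b') \in Q -> (a', b, b') \in Q -> a = a') ->
  (forall q q', q \in Q -> q' \in Q -> ~~ adj q.1.1 q'.1.1) ->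
  dense_linkage D G.
Proof.
move=> lt indX H inj indM; pose M := [set q.1.1 | q in Q].
have QM a b b' : (a, b, b') \in Q -> a \in M by move=> h; apply/imsetP; exists (a, b, b').
exists X, M; split=> //.
- have : 0 < #|Q| by apply: leq_ltn_trans lt.
  rewrite card_gt0 => /set0Pn [[[a b] b'] /H [_ Xb _ _]]; by apply/set0Pn; exists b.
- by move=> x y /imsetP [q qQ ->] /imsetP [q' q'Q ->]; apply: indM.
apply: leq_trans (ltnW lt) _.
have -> : #|Q| = #|[set (q.1.2, q.2) | q in Q]|.
  rewrite card_in_imset // => -[[a b] b'] [[c d] d'] h h' [E E'].
  by move: h'; rewrite -E -E' /= => h'; rewrite (inj _ _ _ _ h h').
rewrite edge_countE pair_big_dep /= -sum1_card big_mkcond [leqRHS]big_mkcond /=.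
apply: leq_sum => -[x y] _; case: ifP => // /imsetP [[[a b] b'] h [-> ->]] /=.
have [nb Xb Xb' E] := H _ _ _ h; rewrite Xb Xb' /= /linked nb /=.
by rewrite lt0b; apply/exists_inP; exists a; [apply: QM h|rewrite E].
Qed.

Section Sampling.
Local Open Scope ring_scope.
Variables (V : finType) (p : rat).
Hypotheses (p0 : 0 < p) (p1 : p <= 1).

(** The expectation of F at a random subset of V that contains each vertex
    independently with probability p. *)
Definition expect (F : {set V} -> rat) : rat :=
  \sum_(S : {set V}) (\prod_v (if v \in S then p else 1 - p)) * F S.

Lemma expect_sum (I : Type) (r : seq I) (P : pred I) (F : I -> {set V} -> rat) :
  expect (fun S => \sum_(i <- r | P i) F i S) = \sum_(i <- r | P i) expect (F i).
Proof. by rewrite exchange_big /=; apply: eq_bigr => S _; rewrite mulr_sumr. Qed.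

Lemma expectD F F' : expect (fun S => F S + F' S) = expect F + expect F'.
Proof. by rewrite -big_split /=; apply: eq_bigr => S _; rewrite mulrDr. Qed.

Lemma expectZ c F : expect (fun S => c * F S) = c * expect F.
Proof. by rewrite mulr_sumr; apply: eq_bigr => S _; rewrite mulrCA. Qed.

Lemma expect_subset (X : {set V}) : expect (fun S => (X \subset S)%:R) = p ^+ #|X|.
Proof.
rewrite /expect (eq_bigr (fun S : {set V} => \prod_v
  (if v \in S then p else (v \notin X)%:R * (1 - p)))) => [|S _]; last first.
  have [/subsetP sX|/subsetPn [x Xx nS]] := boolP (X \subset S).
    rewrite mulr1; apply: eq_bigr => v _; case: ifPn => // nS.
    by rewrite (contra (sX v) nS) mul1r.
  by rewrite mulr0 (bigD1 x) //= (negbTE nS) Xx mul0r mul0r.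
rewrite -bigA_distr (bigID (mem X)) /= [X in _ * X]big1 ?mulr1 => [|v nX].
  rewrite (eq_bigr (fun=> p)) ?prodr_const // => v Xv.
  by rewrite Xv mul0r addr0.
by rewrite nX mul1r addrC subrK.
Qed.

Lemma expect_gt0 F : 0 < expect F -> exists S, 0 < F S.
Proof.
have [/existsP [S h] _|] := boolP [exists S, 0 < F S]; first by exists S.
rewrite negb_exists => /forallP h; rewrite ltNge => /negP []; apply: sumr_le0 => S _.
rewrite mulr_ge0_le0 //; last by rewrite leNgt.
by apply: prodr_ge0 => v _; case: ifP => _; rewrite ?subr_ge0 // ltW.
Qed.

(** First-moment method with union bound: an index i succeeds if the random set
    contains [X i] and does not complete any of its conflicts [C i].  If
    conflicts have probability at most one half given [X i], and the expected
    number of [X i] in the set exceeds 2D times the expected size of its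
    intersection with B, some outcome has more than D successes for each
    sampled element of B. *)
Lemma sampling_success (I : finType) (Q : {set I}) (X : I -> {set V})
    (C : I -> {set {set V}}) (B : {set V}) (D x : nat) :
  (forall i, i \in Q -> #|X i| = x) ->
  (forall i, i \in Q -> 2 * \sum_(Z in C i) p ^+ #|X i :|: Z| <= p ^+ x) ->
  2 * D%:R * #|B|%:R * p < #|Q|%:R * p ^+ x ->
  exists S : {set V}, (D * #|B :&: S| <
    #|[set i in Q | (X i \subset S) && [forall Z in C i, ~~ (X i :|: Z \subset S)]]|)%N.
Proof.
move=> cX cC lt.
pose F (S : {set V}) : rat := \sum_(i in Q) (X i \subset S)%:R +
  ((-1) * (\sum_(i in Q) \sum_(Z in C i) (X i :|: Z \subset S)%:R) +
   (- D%:R) * \sum_(b in B) ([set b] \subset S)%:R).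
have [|S hS] := @expect_gt0 F.
  rewrite /F !expectD !expectZ !expect_sum.
  have -> : \sum_(i in Q) expect (fun S : {set V} => (X i \subset S)%:R) = #|Q|%:R * p ^+ x.
    rewrite (eq_bigr (fun=> p ^+ x)) => [|i iQ]; last by rewrite expect_subset cX.
    by rewrite sumr_const mulr_natl.
  have -> : \sum_(b in B) expect (fun S : {set V} => ([set b] \subset S)%:R) = #|B|%:R * p.
    rewrite (eq_bigr (fun=> p)) => [|b _]; last by rewrite expect_subset cards1.
    by rewrite sumr_const mulr_natl.
  have : 2 * \sum_(i in Q) expect (fun S : {set V} => \sum_(Z in C i) (X i :|: Z \subset S)%:R) <=
     #|Q|%:R * p ^+ x.
    rewrite mulr_sumr mulr_natl -sumr_const; apply: ler_sum => i iQ.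
    by rewrite expect_sum (eq_bigr (fun Z => p ^+ #|X i :|: Z|)) ?cC // => Z _; rewrite expect_subset.
  move: lt; rewrite -!mulrA; move: (_ * p) (_ * p ^+ x) => u v; lra.
exists S; rewrite -(ltr_nat rat) natrM.
have : \sum_(i in Q) (X i \subset S)%:R - \sum_(i in Q) \sum_(Z in C i) (X i :|: Z \subset S)%:R <=
  #|[set i in Q | (X i \subset S) && [forall Z in C i, ~~ (X i :|: Z \subset S)]]|%:R :> rat.
  rewrite card_setsum natr_sum -sumrB; apply: ler_sum => i iQ.
  have [sX|nX] /= := boolP (X i \subset S); last first.
    by rewrite sub0r oppr_le0; apply: sumr_ge0.
  have [_|] := boolP [forall Z in C i, ~~ (X i :|: Z \subset S)].
    by rewrite gerBl; apply: sumr_ge0.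
  rewrite negb_forall_in => /exists_inP [Z CZ]; rewrite negbK => sZ.
  by rewrite (bigD1 Z) //= sZ opprD addNKr oppr_le0; apply: sumr_ge0.
have -> : #|B :&: S|%:R = \sum_(b in B) ([set b] \subset S)%:R :> rat.
  by rewrite setIC card_setIE natr_sum; apply: eq_bigr => b _; rewrite sub1set.
move: hS; rewrite /F; lra.
Qed.

End Sampling.

(** * The unbalanced case: sampling *)

(** Remove vertices of small degree one after the other; each vertex has few
    neighbours among those that are removed later, which get smaller numbers. *)
Lemma degenerate_order (G : sgraph) k (X : {set G}) :
  (forall Y : {set G}, edge_count adj Y Y <= k * #|Y|) ->
  exists ord : G -> nat, {in X &, injective ord} /\
    forall v, v \in X -> #|[set w in X | adj v w && (ord w < ord v)]| <= k.
Proof.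
move=> sp; move: {2}#|X| (erefl #|X|) => n; elim: n X => [|n IH] X cX.
  exists (fun=> 0); move/eqP: cX; rewrite cards_eq0 => /eqP ->.
  by split=> [x y|v]; rewrite inE.
have [v Xv dv] : exists2 v, v \in X & #|nb v :&: X| <= k.
  apply/exists_inP; apply: contraT; rewrite negb_exists_in => /forall_inP h.
  have := sp X; rewrite leqNgt mulnC => /negP []; rewrite -sum_nat_const /edge_count.
  have [v Xv] : exists v, v \in X by apply/card_gt0P; rewrite cX.
  rewrite (bigD1 v) //= [ltnRHS](bigD1 v) //= -addSn leq_add ?ltnNge ?h //.
  by apply: leq_sum => i /andP [Xi _]; rewrite ltnW // ltnNge h.
have [|ord [oI od]] := IH (X :\ v); first by move: cX; rewrite (cardsD1 v) Xv => -[].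
have omax w : ord w < (\max_w ord w).+1 by rewrite ltnS leq_bigmax.
exists (fun w => if w == v then (\max_w ord w).+1 else ord w); split.
  move=> x y Xx Xy; case: eqP => [->|/eqP nx]; case: eqP => [-> //|/eqP ny].
  - by move=> E; have := omax y; rewrite E ltnn.
  - by move=> E; have := omax x; rewrite E ltnn.
  - by apply: oI; rewrite !inE ?nx ?ny ?Xx ?Xy.
move=> w Xw; have [->|nw] := eqVneq w v.
  apply: leq_trans dv; apply: subset_leq_card; apply/subsetP => x.
  by rewrite !inE => /and3P [-> ->].
apply: leq_trans (od w _); last by rewrite !inE nw Xw.
apply: subset_leq_card; apply/subsetP => x; rewrite !inE => /and3P [-> -> ].
case: eqP => [_|_ -> //]; by rewrite ltnNge ltnW.
Qed.

Lemma sum_singletons_le (V : finType) (Y : {set V}) (f : {set V} -> rat) (c : rat) :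
  (forall y, y \in Y -> (f [set y] <= c)%R) ->
  (\sum_(Z in [set [set y] | y in Y]) f Z <= #|Y|%:R * c)%R.
Proof.
move=> h; rewrite big_imset /=; last by move=> x y _ _; apply: set1_inj.
by rewrite mulr_natl -sumr_const; apply: ler_sum.
Qed.

Section Unbalanced.
Variables (G : sgraph) (m D : nat) (A X : {set G}).
Hypotheses (m0 : 0 < m) (disAX : [disjoint A & X]) (X0 : X != set0).
Hypothesis sp : forall Y : {set G}, edge_count adj Y Y <= 2 * m * #|Y|.
Hypothesis dA : forall a, a \in A -> #|nb a :&: X| <= 2 * m.

Definition nonadj (x y : G) := (x != y) && ~~ adj x y.

(** Keeping at most m linking candidates per pair makes it unlikely that two of
    them are sampled at density of order 1/m. *)
Lemma truncated_common (b b' : G) : exists T : {set G},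
  T \subset [set a in A | adj a b && adj a b'] /\ #|T| = minn (codegree A b b') m.
Proof.
set C := [set _ in _ | _]; exists [set x in take m (enum C)]; split.
  by apply/subsetP => x; rewrite inE => /mem_take; rewrite mem_enum.
rewrite cardsE; have /card_uniqP -> : uniq (take m (enum C)) by rewrite take_uniq ?enum_uniq.
by rewrite size_take_min -cardE minnC.
Qed.

Hypothesis rich_pairs : forall b, b \in X ->
  (648 * D).+1 * m ^ 2 <= \sum_(b' in X | nonadj b b') minn (codegree A b b') m.

(** Sample at density 1/(18m).  A triple (a, b, b') has at most 9m conflicts: the
    other neighbours of a in X, the smaller neighbours of a, b and b', and the
    other candidates for the same pair.  So it survives with conditional
    probability at least one half, and by [rich_pairs] the survivors outnumber
    the sampled vertices of X by a factor D.  Excluding smaller neighbours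
    makes both sides of the resulting structure independent. *)
Lemma unbalanced_linkage : dense_linkage D G.
Proof.
have [ord [oI od]] := degenerate_order (A :|: X) sp.
pose Out v := [set w in A :|: X | adj v w && (ord w < ord v)].
have T_ex (bb : G * G) : exists T : {set G},
    (T \subset [set a in A | adj a bb.1 && adj a bb.2]) && (#|T| == minn (codegree A bb.1 bb.2) m).
  by have [T [h1 h2]] := truncated_common bb.1 bb.2; exists T; rewrite h1 h2 eqxx.
pose T b b' := xchoose (T_ex (b, b')).
have TP b b' : T b b' \subset [set a in A | adj a b && adj a b'] /\
    #|T b b'| = minn (codegree A b b') m.
  by have /andP [h1 /eqP h2] := xchooseP (T_ex (b, b')).
pose Q := [set q : G * G * G | [&& q.1.2 \in X, q.2 \in X, nonadj q.1.2 q.2 & q.1.1 \in T q.1.2 q.2]].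
pose base (q : G * G * G) := [set q.1.1; q.1.2; q.2].
pose Y (q : G * G * G) := ((nb q.1.1 :&: X) :|: Out q.1.1 :|: Out q.1.2 :|: Out q.2 :|: T q.1.2 q.2) :\: base q.
have QP a b b' : (a, b, b') \in Q -> [/\ a \in A, b \in X, b' \in X, nonadj b b' &
    [/\ adj a b, adj a b' & a \in T b b']].
  rewrite inE => /and4P [/= Xb Xb' nbb aT]; have [/subsetP /(_ _ aT)] := TP b b'.
  by rewrite inE => /and3P [Aa ab ab'] _; split.
have nAX a : a \in A -> a \notin X by move=> Aa; rewrite (disjointFr disAX).
have cQ : (648 * D).+1 * m ^ 2 * #|X| <= #|Q|.
  have -> : #|Q| = \sum_(b in X) \sum_(b' in X | nonadj b b') #|T b b'|.
    rewrite -sum1_card.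
    rewrite (eq_bigr (fun b => \sum_(b' in X | nonadj b b') \sum_(a in T b b') 1)) => [|b _]; last first.
      by apply: eq_bigr => b' _; rewrite sum1_card.
    rewrite pair_big_dep /= pair_big_dep /=.
    rewrite (reindex (fun x : G * G * G => (x.2, x.1.1, x.1.2))) /=.
      by apply: eq_bigl => -[[b b'] a]; rewrite inE /= !andbA.
    by exists (fun q : G * G * G => (q.1.2, q.2, q.1.1)) => [[[b b'] a]|[[a b] b']].
  rewrite mulnC -sum_nat_const; apply: leq_sum => b Xb; apply: leq_trans (rich_pairs Xb) _.
  by apply: leq_sum => b' _; have [_ ->] := TP b b'.
have cbase q : q \in Q -> #|base q| = 3.
  case: q => [[a b] b'] /QP [Aa Xb Xb' /andP [nbb _] _].
  rewrite /base /= setUC cardsU1 cards2 !inE /= negb_or.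
  have ne x : x \in X -> a != x by move=> Xx; apply: contraNneq (nAX _ Aa) => ->.
  by rewrite (ne b Xb) (eq_sym b' a) (ne b' Xb') (eq_sym b' b) nbb.
have cY q : q \in Q -> #|Y q| <= 9 * m.
  case: q => [[a b] b'] /QP [Aa Xb Xb' _ [_ _ aT]].
  have cOut v : v \in A :|: X -> #|Out v| <= 2 * m by apply: od.
  apply: leq_trans (subset_leq_card (subsetDl _ _)) _ => /=.
  have h1 := dA Aa; have h2 := cOut a; have h3 := cOut b; have h4 := cOut b'.
  rewrite !inE ?Aa ?Xb ?Xb' ?orbT in h2 h3 h4.
  have [_ h5] := TP b b'; have h6 : #|T b b'| <= m by rewrite h5 geq_minr.
  rewrite !cardsU.
  move: h1 (h2 isT) (h3 isT) (h4 isT) h6; clear; lia.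
pose p : rat := ((18 * m)%:R^-1)%R.
have p0 : (0 < p)%R by rewrite invr_gt0 ltr0n muln_gt0.
have p1 : (p <= 1)%R.
  by rewrite invf_le1 ?ltr0n ?ler1n ?muln_gt0.
have pm : (18 * m%:R * p = 1 :> rat)%R.
  by rewrite -natrM mulfV // pnatr_eq0 -lt0n muln_gt0.
have [||S hS] := @sampling_success _ p p0 p1 _ Q base (fun q => [set [set y] | y in Y q]) X D 3 cbase.
- move=> q qQ; have h : (\sum_(Z in [set [set y] | y in Y q]) p ^+ #|base q :|: Z| <= #|Y q|%:R * p ^+ 4)%R.
    apply: sum_singletons_le => y; rewrite !inE => /andP [yb _].
    by rewrite setUC cardsU1 !inE yb cbase.
  have h' : (#|Y q|%:R * p ^+ 4 <= (9 * m)%:R * p ^+ 4)%R.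
    by rewrite ler_wpM2r ?exprn_ge0 ?ler_nat ?cY // ltW.
  have e : (2 * ((9 * m)%:R * p ^+ 4) = (18 * m%:R * p) * p ^+ 3 :> rat)%R.
    by rewrite natrM; ring.
  by move: h h' e; rewrite pm mul1r; move: (\sum_(_ in _) _)%R => s; lra.
- have e : (#|Q|%:R * p ^+ 3 = #|Q|%:R * p ^+ 2 * p :> rat)%R by ring.
  rewrite e ltr_pM2r //.
  have h : (((648 * D).+1 * m ^ 2 * #|X|)%:R * p ^+ 2 <= #|Q|%:R * p ^+ 2)%R.
    by rewrite ler_wpM2r ?exprn_ge0 ?ler_nat // ltW.
  apply: lt_le_trans h.
  have -> : (((648 * D).+1 * m ^ 2 * #|X|)%:R * p ^+ 2 =
     (648 * D).+1%:R * #|X|%:R * (18 * m%:R * p) ^+ 2 / 324 :> rat)%R.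
    by rewrite !natrM; field.
  have -> : ((648 * D).+1%:R = 648 * D%:R + 1 :> rat)%R by rewrite -addn1 natrD natrM.
  rewrite pm expr1n mulr1.
  have : (0 < #|X|%:R :> rat)%R by rewrite ltr0n card_gt0.
  move: (#|X|%:R : rat)%R (D%:R : rat)%R => x d x0.
  rewrite mulrDl; lra.
move: hS; set Q' := [set i in Q | _] => hS.
have Q'P q : q \in Q' -> [/\ q \in Q, base q \subset S & forall y, y \in Y q -> y \notin S].
  rewrite inE => /and3P [qQ sb /forall_inP h]; split=> // y yY.
  by have := h [set y]; rewrite imset_f // subUset sb /= sub1set; apply.
pose X' := [set b in X :&: S | Out b :&: (X :&: S) == set0].
have sX' : X' \subset X :&: S by apply/subsetP => x; rewrite inE => /andP [].
have conf a b b' y : (a, b, b') \in Q' -> y \in S -> y != a -> y != b -> y != b' ->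
    [/\ y \in nb a -> y \notin X, y \notin Out a, y \notin Out b, y \notin Out b' & y \notin T b b'].
  move=> /Q'P [_ _ h] yS na nbb nb'.
  have : y \notin Y (a, b, b') by apply: contraL yS => /h.
  by rewrite in_setD !in_setU !in_set1 (negbTE na) (negbTE nbb) (negbTE nb') /= in_setI !negb_or negb_and
    => /andP [/andP [/andP [/andP [/orP [h1|h1] h2] h3] h4] h5]; split=> //; rewrite (negbTE h1).
have inS a b b' : (a, b, b') \in Q' -> [/\ a \in S, b \in S & b' \in S].
  by move=> /Q'P [_ /subsetP h _]; split; apply: h; rewrite !inE eqxx ?orbT.
have endX a b b' : (a, b, b') \in Q' -> b \in X' /\ b' \in X'.
  move=> h; have [/QP [Aa Xb Xb' /andP [nbb nabb] [ab ab' aT]] _ _] := Q'P _ h.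
  have [aS bS b'S] := inS _ _ _ h.
  suff st c : (c == b) || (c == b') -> c \in X'.
    by split; apply: st; rewrite eqxx ?orbT.
  move=> hc; have cXS : c \in X :&: S by case/orP: hc => /eqP ->; rewrite inE ?Xb ?Xb' ?bS ?b'S.
  rewrite inE cXS; apply/eqP/setP => y; rewrite in_set0; apply/negbTE/negP.
  rewrite in_setI => /andP [yO]; rewrite inE => /andP [Xy Sy].
  have ya : y != a by apply: contraTneq Xy => ->; apply: nAX.
  have acy : adj c y by move: yO; rewrite inE => /and3P [].
  have yb : y != b.
    apply: contraTneq acy => ->; case/orP: hc => /eqP ->; first by rewrite adj_irrefl.
    by rewrite adj_sym.
  have yb' : y != b'.
    apply: contraTneq acy => ->; case/orP: hc => /eqP -> //; by rewrite adj_irrefl.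
  have [_ _ n1 n2 _] := conf _ _ _ _ h Sy ya yb yb'.
  by case/orP: hc => /eqP E; move: yO; rewrite E ?(negbTE n1) ?(negbTE n2).
apply: (@linkage_of_cherries _ D X' Q').
- by apply: leq_ltn_trans hS; rewrite leq_mul2l subset_leq_card ?orbT.
- have key x y : x \in X' -> y \in X' -> ord y < ord x -> ~~ adj x y.
    rewrite inE => /andP [xXS /eqP /setP /(_ y)]; rewrite in_set0 in_setI => h yX lt.
    apply: contraFN h => axy; rewrite (subsetP sX' _ yX) andbT.
    rewrite inE axy lt !andbT.
    by have := subsetP sX' _ yX; rewrite in_setU inE => /andP [-> _]; rewrite orbT.
  move=> x y Xx Xy; have [lt|gt|E] := ltngtP (ord x) (ord y).
  + by rewrite adj_sym key.
  + exact: key.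
  + have /setIP [x1 _] := subsetP sX' _ Xx; have /setIP [y1 _] := subsetP sX' _ Xy.
    by rewrite (oI x y) ?adj_irrefl // in_setU ?x1 ?y1 orbT.
- move=> a b b' h; have [/QP [Aa Xb Xb' /andP [nbb nabb] [ab ab' aT]] _ _] := Q'P _ h.
  have [bX b'X] := endX _ _ _ h; split=> //; apply/setP => y; rewrite in_setI in_nbr in_set2.
  apply/idP/idP; last by case/orP => /eqP ->; rewrite ?ab ?ab' ?bX ?b'X.
  case/andP => ay yX'; have /setIP [Xy Sy] := subsetP sX' _ yX'; apply: contraT; rewrite negb_or => /andP [yb yb'].
  have ya : y != a by apply: contraTneq Xy => ->; apply: nAX.
  by have [h1 _ _ _ _] := conf _ _ _ _ h Sy ya yb yb'; have := h1; rewrite in_nbr ay Xy; apply.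
- move=> a a' b b' h h'; apply/eqP; apply: contraT => ne.
  have [/QP [Aa Xb Xb' _ _] _ _] := Q'P _ h.
  have [/QP [Aa' _ _ _ [_ _ aT']] _ _] := Q'P _ h'.
  have [aS' _ _] := inS _ _ _ h'.
  have nx x : x \in X -> a' != x by move=> Xx; apply: contraNneq (nAX _ Aa') => ->.
  rewrite eq_sym in ne.
  by have [_ _ _ _] := conf _ _ _ _ h aS' ne (nx _ Xb) (nx _ Xb'); rewrite aT'.
- have key q q' : q \in Q' -> q' \in Q' -> ord q'.1.1 < ord q.1.1 -> ~~ adj q.1.1 q'.1.1.
    case: q q' => [[a b] b'] [[c d] d'] h h' /= lt; apply/negP => ac.
    have [/QP [Aa Xb Xb' _ _] _ _] := Q'P _ h.
    have [/QP [Ac _ _ _ _] _ _] := Q'P _ h'.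
    have [cS _ _] := inS _ _ _ h'.
    have nx x : x \in X -> c != x by move=> Xx; apply: contraNneq (nAX _ Ac) => ->.
    have ca : c != a by apply: contraTneq ac => ->; rewrite adj_irrefl.
    have [_ n1 _ _ _] := conf _ _ _ _ h cS ca (nx _ Xb) (nx _ Xb').
    by move: n1; rewrite inE in_setU Ac ac lt.
  move=> q q' h h'; have [lt|gt|E] := ltngtP (ord q.1.1) (ord q'.1.1).
  + by rewrite adj_sym key.
  + exact: key.
  + case: q q' h h' E => [[a b] b'] [[c d] d'] h h' /= E.
    have [/QP [Aa _ _ _ _] _ _] := Q'P _ h.
    have [/QP [Ac _ _ _ _] _ _] := Q'P _ h'.
    by rewrite (oI a c) ?adj_irrefl // in_setU ?Aa ?Ac.
Qed.

End Unbalanced.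

(** * The unbalanced case: cleaning *)

Lemma codegreeE (G : sgraph) (A : {set G}) x y :
  codegree A x y = #|nb y :&: (nb x :&: A)|.
Proof.
rewrite /codegree; congr #|pred_of_set _|; apply/setP => a; rewrite !inE.
by rewrite [adj x a]adj_sym [adj y a]adj_sym; case: (a \in A); case: (adj a x); rewrite ?andbF ?andbT.
Qed.

Lemma codegreeC (G : sgraph) (A : {set G}) x y : codegree A x y = codegree A y x.
Proof.
rewrite /codegree; congr #|pred_of_set _|; apply/setP => a; rewrite !inE.
by congr (_ && _); rewrite andbC.
Qed.

Lemma sum_codegree (G : sgraph) (A B : {set G}) x :
  \sum_(y in B) codegree A x y = edge_count adj B (nb x :&: A).
Proof. by apply: eq_bigr => y _; rewrite codegreeE. Qed.

Lemma pair_sum_removal (T : finType) (h : T -> T -> nat) (X : {set T}) b :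
  (forall x y, h x y = h y x) -> (forall x, h x x = 0) -> b \in X ->
  \sum_(x in X) \sum_(y in X) h x y =
  \sum_(x in X :\ b) \sum_(y in X :\ b) h x y + 2 * \sum_(y in X) h b y.
Proof.
move=> hC h0 Xb; rewrite (big_setD1 b) //=.
have E x : \sum_(y in X) h x y = h x b + \sum_(y in X :\ b) h x y by rewrite (big_setD1 b).
rewrite [X in _ + X](eq_bigr _ (fun x _ => E x)) big_split /= E h0 add0n.
have -> : \sum_(i in X :\ b) h i b = \sum_(i in X :\ b) h b i by apply: eq_bigr.
lia.
Qed.

(** All but t vertices of N have at least |N|/q nonneighbours in N, themselves
    included. *)
Lemma nonadj_pairs (G : sgraph) q t (N : {set G}) : nonadjacency_rich q t G -> 0 < q ->
  2 * t <= #|N| -> 2 * q <= #|N| ->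
  #|N| ^ 2 <= 4 * q * \sum_(x in N) \sum_(y in N) nonadj x y.
Proof.
move=> rich q0 tN qN.
pose bad := [set x in N | q * #|N :\: nb x| < #|N|].
have cb : #|bad| <= t by apply: (card_mostly_adjacent_le rich); move: tN; clear; lia.
have sb : bad \subset N by apply/subsetP => x; rewrite inE => /andP [].
have lower : #|N :\: bad| * (#|N| - q) <= q * \sum_(x in N) \sum_(y in N) nonadj x y.
  rewrite -sum_nat_const big_distrr /= [leqRHS](bigID (mem bad)) /= -[leqLHS]add0n leq_add //.
  rewrite [leqRHS](eq_bigl (mem (N :\: bad))) => [|x]; last by rewrite /= in_setD andbC.
  apply: leq_sum => x; rewrite !inE => /andP [h Nx]; rewrite Nx /= -leqNgt in h.
  rewrite -(card_setsum N (nonadj x)) leq_subLR -mulnS; apply: leq_trans h _.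
  rewrite leq_mul2l; apply/orP; right.
  rewrite (cardsD1 x) !inE adj_irrefl Nx add1n ltnS; apply: subset_leq_card.
  by apply/subsetP => y; rewrite !inE /nonadj eq_sym => /and3P [-> -> ->].
move: lower; rewrite cardsD (setIidPr sb); move: (\sum_(_ in _) _) => s.
by move: #|N| #|bad| cb tN qN => d b; clear; nia.
Qed.

Section UnbalancedCase.
Variables (G : sgraph) (q t D m n : nat) (A L : {set G}).
Hypotheses (rich : nonadjacency_rich q t G) (q0 : 0 < q) (t0 : 0 < t) (n0 : 0 < n).
Let D2 := (648 * D).+1.
Let zeta := 4096 * q.
Let beta := 4 * D2.
Hypotheses (tm : 32 * t <= m) (qm : 32 * q <= m).
Hypothesis (dm : 4 * zeta * dense_const q D (4 * zeta * D2) * t <= m).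
Hypothesis (disAL : [disjoint A & L]).
Hypothesis sp : forall Y : {set G}, edge_count adj Y Y <= 2 * m * #|Y|.
Hypothesis dA : forall a, a \in A -> #|nb a :&: L| <= 2 * m.
Hypotheses (cA : #|A| <= n) (cL : zeta * beta * #|L| <= n).
Hypothesis eAL : m * n <= 8 * edge_count adj A L.

Let h b b' := nonadj b b' * codegree A b b'.

Let m0 : 0 < m. Proof. by apply: leq_trans tm; rewrite muln_gt0. Qed.

(** Vertices a with fewer than m/16 neighbours in L carry at most half of the
    edges between A and L, so the quadratic bound [nonadj_pairs] for the other
    ones suffices. *)
Lemma nonadj_cherries : m ^ 2 * n <= 1024 * q * \sum_(b in L) \sum_(b' in L) h b b'.
Proof.
rewrite -sum_pairs_common_nbr.
set cnt := \sum_(_ in _) _.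
have : 16 * m * edge_count adj A L <= 1024 * q * cnt + m ^ 2 * #|A|.
  rewrite /edge_count /cnt [m ^ 2 * _]mulnC -sum_nat_const !big_distrr /= -big_split /=.
  apply: leq_sum => a Aa; set N := nb a :&: L; set s := \sum_(_ in _) _.
  have [big|small] := leqP m (16 * #|N|).
    have : #|N| ^ 2 <= 4 * q * s by apply: nonadj_pairs rich q0 _ _; lia.
    by rewrite /s; move: (\sum_(_ in _) _) #|N| big => s' d; clear; nia.
  by apply: leq_trans (leq_addl _ _); move: small; move: #|N| => d; clear; nia.
by move: cnt (edge_count _ _ _) eAL cA => c e; clear; nia.
Qed.

(** A minimal subset of L with many cherries relative to a cost charged to each
    of its vertices: deleting a vertex that lies in too few cherries would give
    a smaller one. *)
Lemma cleaned_side : exists X : {set G}, [/\ X \subset L, X != set0 &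
  forall b, b \in X -> m * #|nb b :&: A| + zeta * beta * m ^ 2 <=
    2 * zeta * \sum_(b' in X) h b b'].
Proof.
pose cost b := m * #|nb b :&: A| + zeta * beta * m ^ 2.
pose g (X : {set G}) := \sum_(b in X) \sum_(b' in X) h b b'.
pose good (X : {set G}) := (X \subset L) && (\sum_(b in X) cost b < zeta * g X).
have gL : good L.
  rewrite /good subxx /= big_split /= -big_distrr /= sum_nat_const.
  have := nonadj_cherries; rewrite -/(g L).
  have -> : \sum_(b in L) #|nb b :&: A| = edge_count adj A L by rewrite edge_countC //; apply: adj_sym.
  have : edge_count adj A L <= 2 * m * #|A|.
    by rewrite mulnC -sum_nat_const; apply: leq_sum.
  have : 0 < m ^ 2 * n by rewrite muln_gt0 expn_gt0 m0.
  have -> : m * edge_count adj A L + #|L| * (zeta * beta * m ^ 2) =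
    m * edge_count adj A L + zeta * beta * #|L| * m ^ 2 by ring.
  have cL' : zeta * beta * #|L| * m ^ 2 <= m ^ 2 * n by rewrite mulnC leq_mul2l cL orbT.
  move: cL'; move: (zeta * beta * #|L| * m ^ 2) => u; rewrite /zeta.
  move: (g L) (edge_count _ _ _) cA => c e; move: #|A| => a; clear; nia.
have [X /minsetP [/andP [sX lt] minX] _] := minset_exists gL.
exists X; split=> //.
  by apply: contraTneq lt => ->; rewrite /g !big_set0 muln0.
move=> b Xb; rewrite leqNgt; apply/negP => small.
have : good (X :\ b).
  rewrite /good (subset_trans (subsetDl _ _) sX) /=.
  move: lt; rewrite (big_setD1 b) //= /g (@pair_sum_removal _ h X b) //.
  - move: small; rewrite -/(cost b) -/(g (X :\ b)); move: (g _) (cost b) (\sum_(_ in _) _) (\sum_(_ in _) _).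
    by clear; nia.
  - by move=> x y; rewrite /h codegreeC /nonadj eq_sym adj_sym.
  - by move=> x; rewrite /h /nonadj eqxx.
by move=> /minX /(_ (subsetDl _ _)) /setP /(_ b); rewrite !inE eqxx Xb.
Qed.

(** If a vertex b of the cleaned side fails to have enough distinct partners,
    at least half of its cherries go to partners b' with more than m common neighbours.
    There are only O(m) of these, while the cherries at b number a constant
    times m|N(b)|; so they form a dense pair with the neighbourhood of b. *)
Lemma unbalanced_case : dense_linkage D G.
Proof.
have [X [sX X0 tau]] := cleaned_side.
have disAX : [disjoint A & X] by apply: disjointWr disAL.
have dAX a : a \in A -> #|nb a :&: X| <= 2 * m.
  by move=> /dA; apply: leq_trans; apply: subset_leq_card; apply: setIS.
pose W b := \sum_(b' in X | nonadj b b') minn (codegree A b b') m.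
have [/forall_inP H|] := boolP [forall b in X, D2 * m ^ 2 <= W b].
  exact: unbalanced_linkage m0 disAX X0 sp dAX H.
rewrite negb_forall_in => /exists_inP [b Xb]; rewrite -ltnNge => small.
pose P := [set b' in X | nonadj b b' && (m < codegree A b b')].
have hsum : \sum_(b' in X) h b b' <= W b + \sum_(b' in P) codegree A b b'.
  rewrite /W big_mkcondr [X in _ + X](eq_bigl (fun b' => (b' \in X) && (nonadj b b' && (m < codegree A b b')))) => [|x]; last by rewrite inE.
  rewrite [X in _ + X]big_mkcondr /= -big_split /=; apply: leq_sum => b' _; rewrite /h.
  case: (nonadj b b') => //=; rewrite mul1n; case: ltnP => h'; first exact: leq_addl.
  by rewrite addn0.
have cP : #|P| * m <= W b.
  rewrite -sum_nat_const /W [leqRHS](bigID (mem P)) /= -[leqLHS]addn0 leq_add //.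
  rewrite [leqRHS](eq_bigl (mem P)) => [|x]; last first.
    by rewrite /= inE; case: (x \in X); case: (nonadj b x).
  by apply: leq_sum => b'; rewrite inE => /and3P [_ _ lt]; rewrite (minn_idPr (ltnW lt)).
set d := #|nb b :&: A|.
have tau_le : \sum_(b' in X) h b b' <= 2 * m * d.
  apply: (@leq_trans (\sum_(b' in X) codegree A b b')).
    by apply: leq_sum => b' _; rewrite /h; case: (nonadj b b'); rewrite ?mul1n.
  rewrite sum_codegree edge_countC; last exact: adj_sym.
  by rewrite mulnC -sum_nat_const; apply: leq_sum => a /setIP [_]; apply: dAX.
have Pe : \sum_(b' in P) codegree A b b' = edge_count adj (nb b :&: A) P.
  by rewrite sum_codegree edge_countC //; apply: adj_sym.
have Ple : edge_count adj (nb b :&: A) P <= d * #|P|.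
  by rewrite -sum_nat_const; apply: leq_sum => a _; apply: subset_leq_card (subsetIr _ _).
have := tau _ Xb; rewrite -/d => tb.
move: hsum tau_le cP small tb Ple; rewrite Pe.
set e := edge_count _ _ _; move: (\sum_(_ in _) _) (W b) => s w hsum tau_le cP small tb Ple.
have z0 : 0 < zeta by rewrite muln_gt0.
have D0 : 0 < D2 by [].
have s1 : beta * m ^ 2 <= 2 * s.
  rewrite -(leq_pmul2l z0) (mulnA zeta beta) (mulnA zeta 2) (mulnC zeta 2).
  exact: leq_trans (leq_addl _ _) tb.
have s2 : m * d <= 2 * zeta * s by apply: leq_trans tb; rewrite leq_addr.
have e1 : s <= 2 * e by move: s1 small hsum; rewrite /beta; clear; lia.
have dm1 : m <= d.
  have : beta * m ^ 2 <= 4 * (m * d) by move: s1 tau_le; clear; nia.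
  by move: m0 D0; rewrite /beta; clear; nia.
have c1 : #|P| <= D2 * m.
  by rewrite -(leq_pmul2r m0); move: cP small; clear; nia.
have dense : d * #|P| <= 4 * zeta * D2 * e.
  apply: (@leq_trans (D2 * (m * d))); first by rewrite mulnC mulnCA mulnA leq_mul2r mulnC c1 orbT.
  apply: (@leq_trans (D2 * (2 * zeta * (2 * e)))); last by rewrite leq_eqVlt; apply/orP; left; apply/eqP; ring.
  by rewrite leq_mul2l (leq_trans s2) ?orbT // leq_mul2l e1 orbT.
have P1 : m <= 4 * zeta * #|P|.
  have d0 : 0 < d by apply: leq_trans dm1.
  rewrite -(leq_pmul2r d0); apply: leq_trans s2 _; move: e1 Ple; clear; nia.
have z40 : 0 < 4 * zeta by rewrite muln_gt0.
apply: (@dense_pair_linkage G q t rich q0 t0 D (4 * zeta * D2) (nb b :&: A) P).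
- by rewrite muln_gt0 z40.
- apply: leq_trans dm1; apply: leq_trans dm; rewrite -[leqRHS]mulnA.
  by rewrite leq_pmull.
- by rewrite -(leq_pmul2l z40) mulnA; apply: leq_trans P1.
- exact: dense.
Qed.

End UnbalancedCase.

(** * The regular case: girth five *)

Lemma card_triples (T : finType) (A : {set T}) (B : T -> {set T}) (C : T -> T -> {set T}) :
  #|[set q : T * T * T | [&& q.1.1 \in A, q.1.2 \in B q.1.1 & q.2 \in C q.1.1 q.1.2]]| =
  \sum_(a in A) \sum_(b in B a) #|C a b|.
Proof.
rewrite -sum1_card.
rewrite [RHS](eq_bigr (fun a => \sum_(b in B a) \sum_(c in C a b) 1)) => [|a _]; last first.
  by apply: eq_bigr => b _; rewrite sum1_card.
rewrite pair_big_dep /= pair_big_dep /=.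
by apply: eq_bigl => -[[a b] c]; rewrite inE /= !andbA.
Qed.

Section GirthFive.
Variables (G : sgraph) (D Dl l M : nat) (S : {set G}).
Hypothesis tri : forall u v w, u \in S -> v \in S -> w \in S ->
  adj u v -> adj u w -> ~~ adj v w.
Hypothesis c4 : forall u w x y, u \in S -> w \in S -> x \in S -> y \in S -> u != w ->
  adj u x -> adj w x -> adj u y -> adj w y -> x = y.
Hypothesis deg : forall v, v \in S -> #|nb v :&: S| <= Dl.
Hypotheses (S0 : S != set0) (dens : l * #|S| <= edge_count adj S S) (l2 : 2 <= l).
Hypotheses (M0 : 0 < M) (M1 : 12 * Dl <= M) (M2 : 4 * Dl ^ 3 <= M ^ 2) (M3 : 4 * D * M < l ^ 2).

(** Sample U at density 1/M, where M may be of order l^2.  A cherry (a, b, b') with ends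
    in U is disturbed by a further vertex of U adjacent to one of a, b, b', or by
    a neighbour of a with two neighbours in U.  There are O(Dl) choices of the
    former, each of probability 1/M, and at most Dl^3 of the latter, each of
    probability 1/M^2, because in the absence of triangles these two neighbours
    differ from b and b'.  As there are no four-cycles, b and b' determine a. *)
Lemma girth_five_linkage : dense_linkage D G.
Proof.
pose N v := nb v :&: S.
pose Q := [set q : G * G * G | [&& q.1.1 \in S, q.1.2 \in N q.1.1 & q.2 \in N q.1.1 :\ q.1.2]].
have QP a b b' : (a, b, b') \in Q -> [/\ a \in S, b \in S, b' \in S, b != b' & adj a b /\ adj a b'].
  by rewrite !inE eq_sym => /= /and5P [-> /andP [-> ->] -> -> ->].
have cQ : l ^ 2 * #|S| <= 2 * #|Q|.
  have h : 2 * l * edge_count adj S S <= #|Q| + edge_count adj S S + l ^ 2 * #|S|.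
    rewrite /Q (card_triples S N (fun a b => N a :\ b)) /edge_count [l ^ 2 * _]mulnC -sum_nat_const big_distrr -!big_split /=.
    apply: leq_sum => a Sa; rewrite -/(N a).
    have -> : \sum_(b in N a) #|N a :\ b| = #|N a| * (#|N a| - 1).
      rewrite -sum_nat_const; apply: eq_bigr => b Nb.
      by rewrite (cardsD1 b (N a)) Nb add1n subn1.
    have -> : #|N a| * (#|N a| - 1) + #|N a| = #|N a| ^ 2.
      by case: #|N a| => // d; rewrite subn1 addnC -mulnS mulnn.
    by rewrite -mulnA mulnC [l * _]mulnC mulnC; apply: nat_Cauchy.
  move: h dens l2; move: (edge_count _ _ _) #|S| #|Q| => e s c; clear; nia.
pose base (q : G * G * G) := [set q.1.2; q.2].
have cbase q : q \in Q -> #|base q| = 2.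
  by case: q => [[a b] b'] /QP [_ _ _ ne _]; rewrite cards2 ne.
pose Y (q : G * G * G) := (N q.1.1 :|: N q.1.2 :|: N q.2) :\: base q.
pose P2 (q : G * G * G) := [set Z : {set G} | [&& #|Z| == 2, [disjoint Z & base q] &
  [exists a in N q.1.1, Z \subset N a]]].
pose C q := [set [set y] | y in Y q] :|: P2 q.
have cY q : q \in Q -> #|Y q| <= 3 * Dl.
  case: q => [[a b] b'] /QP [Sa Sb Sb' _ _].
  apply: leq_trans (subset_leq_card (subsetDl _ _)) _; rewrite !cardsU /=.
  by move: (deg Sa) (deg Sb) (deg Sb'); rewrite -/(N a) -/(N b) -/(N b'); clear; lia.
have cP2 q : q \in Q -> #|P2 q| <= Dl ^ 3.
  case: q => [[a b] b'] /QP [Sa _ _ _ _].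
  pose Tr := [set q : G * G * G | [&& q.1.1 \in N a, q.1.2 \in N q.1.1 & q.2 \in N q.1.1]].
  have cT : #|Tr| <= Dl ^ 3.
    rewrite /Tr (card_triples (N a) N (fun x _ => N x)) expnS.
    apply: (@leq_trans (#|N a| * Dl ^ 2)); last by rewrite leq_mul2r deg ?orbT.
    rewrite -sum_nat_const; apply: leq_sum => x /setIP [_ Sx].
    by rewrite sum_nat_const expnS expn1; apply: leq_mul; apply: deg.
  apply: leq_trans cT; apply: leq_trans (leq_imset_card (fun q : G * G * G => [set q.1.2; q.2]) _).
  apply: subset_leq_card; apply/subsetP => Z; rewrite inE => /and3P [/cards2P [x [y [_ ->]]] _ /exists_inP [c Nc]].
  rewrite subUset !sub1set => /andP [xc yc]; apply/imsetP; exists (c, x, y) => //.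
  by rewrite inE /= Nc xc yc.
pose p : rat := ((M)%:R^-1)%R.
have p0 : (0 < p)%R by rewrite invr_gt0 ltr0n.
have p1 : (p <= 1)%R by rewrite invf_le1 ?ltr0n // ler1n.
have pM : (M%:R * p = 1 :> rat)%R by rewrite mulfV // pnatr_eq0 -lt0n.
have [||U hU] := @sampling_success _ p p0 p1 _ Q base C S D 2 cbase.
- move=> q qQ.
  have -> : (\sum_(Z in C q) p ^+ #|base q :|: Z| =
     \sum_(Z in [set [set y] | y in Y q]) p ^+ #|base q :|: Z| + \sum_(Z in P2 q) p ^+ #|base q :|: Z|)%R.
    rewrite -bigU /=; first by apply: eq_bigl => Z; rewrite !inE.
    rewrite disjoint_subset; apply/subsetP => Z /imsetP [y _ ->].
    by rewrite inE /= inE cards1.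
  have h1 : (\sum_(Z in [set [set y] | y in Y q]) p ^+ #|base q :|: Z| <= #|Y q|%:R * p ^+ 3)%R.
    apply: sum_singletons_le => y; rewrite !inE => /andP [yb _].
    by rewrite setUC cardsU1 !inE yb cbase.
  have h2 : (\sum_(Z in P2 q) p ^+ #|base q :|: Z| <= #|P2 q|%:R * p ^+ 4)%R.
    rewrite mulr_natl -sumr_const; apply: ler_sum => Z; rewrite inE => /and3P [/eqP cZ dZ _].
    by rewrite cardsU cZ cbase // setIC (disjoint_setI0 dZ) cards0.
  have h1' : (#|Y q|%:R * p ^+ 3 <= (3 * Dl)%:R * p ^+ 3)%R.
    by rewrite ler_wpM2r ?exprn_ge0 ?ler_nat ?cY // ltW.
  have h2' : (#|P2 q|%:R * p ^+ 4 <= (Dl ^ 3)%:R * p ^+ 4)%R.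
    by rewrite ler_wpM2r ?exprn_ge0 ?ler_nat ?cP2 // ltW.
  have h3 : (4 * ((3 * Dl)%:R * p ^+ 3) <= p ^+ 2)%R.
    have -> : (p ^+ 2 = M%:R * p * p ^+ 2)%R by rewrite pM mul1r.
    have -> : (4 * ((3 * Dl)%:R * p ^+ 3) = (12 * Dl)%:R * p * p ^+ 2 :> rat)%R.
      by rewrite !natrM; ring.
    by rewrite ler_pM2r ?exprn_gt0 // ler_pM2r // ler_nat.
  have h4 : (4 * ((Dl ^ 3)%:R * p ^+ 4) <= p ^+ 2)%R.
    have -> : (p ^+ 2 = (M%:R * p) ^+ 2 * p ^+ 2)%R by rewrite pM expr1n mul1r.
    have -> : ((M%:R * p) ^+ 2 * p ^+ 2 = (M ^ 2)%:R * p ^+ 4 :> rat)%R by rewrite natrX; ring.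
    have -> : (4 * ((Dl ^ 3)%:R * p ^+ 4) = (4 * Dl ^ 3)%:R * p ^+ 4 :> rat)%R.
      by rewrite natrM mulrA.
    by rewrite ler_pM2r ?exprn_gt0 // ler_nat.
  move: h1 h2 h1' h2' h3 h4; move: (\sum_(_ in _) _)%R => s1.
  by move: (\sum_(_ in P2 q) _)%R (_ * p ^+ 4)%R (_ * p ^+ 4)%R => s2 x y; lra.
- have e : (#|Q|%:R * p ^+ 2 = #|Q|%:R * p * p :> rat)%R by ring.
  rewrite e ltr_pM2r //.
  have h : ((2 * D * #|S| * M)%:R * p < #|Q|%:R * p)%R.
    rewrite ltr_pM2r // ltr_nat; have s0 : 0 < #|S| by rewrite card_gt0.
    by move: cQ M3 s0; move: #|S| #|Q| => s c; clear; nia.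
  apply: le_lt_trans h.
  have -> : ((2 * D * #|S| * M)%:R * p = 2 * D%:R * #|S|%:R * (M%:R * p) :> rat)%R.
    by rewrite !natrM; ring.
  by rewrite pM mulr1.
move: hU; set Q' := [set i in Q | _] => hU.
pose V := S :&: U.
pose X' := [set b in V | nb b :&: V == set0].
have sX' : X' \subset V by apply/subsetP => x; rewrite inE => /andP [].
have Q'P q : q \in Q' -> [/\ q \in Q, base q \subset U, forall y, y \in Y q -> y \notin U &
    forall Z, Z \in P2 q -> ~~ (Z \subset U)].
  rewrite inE => /and3P [qQ sb /forall_inP h]; split=> // [y yY|Z ZP].
    by have := h [set y]; rewrite in_setU imset_f // subUset sb /= sub1set; apply.
  by have := h Z; rewrite in_setU ZP orbT subUset sb /=; apply.
have inV a b b' : (a, b, b') \in Q' -> b \in V /\ b' \in V.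
  move=> /Q'P [/QP [_ Sb Sb' _ _] /subsetP h _ _].
  by rewrite !in_setI Sb Sb' !h ?inE ?eqxx ?orbT.
have conf a b b' y : (a, b, b') \in Q' -> y \in V -> y != b -> y != b' ->
    [/\ ~~ adj a y, ~~ adj b y & ~~ adj b' y].
  move=> /Q'P [_ _ h _] /setIP [Sy Uy] yb yb'.
  have : y \notin Y (a, b, b') by apply: contraL Uy => /h.
  rewrite in_setD !in_setU !in_set1 (negbTE yb) (negbTE yb') /= !in_setI !Sy !andbT !in_nbr.
  by rewrite !negb_or => /andP [/andP [-> ->] ->].
have endX a b b' : (a, b, b') \in Q' -> b \in X' /\ b' \in X'.
  move=> h; have [/QP [Sa Sb Sb' ne [ab ab']] _ _ _] := Q'P _ h; have [Vb Vb'] := inV _ _ _ h.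
  have nbb' : ~~ adj b b' by apply: (tri Sa).
  split; rewrite inE ?Vb ?Vb'; apply/eqP/setP => y; rewrite in_set0 in_setI in_nbr; apply/negbTE/negP => /andP [by' Vy].
    have yb : y != b by apply: contraTneq by' => ->; rewrite adj_irrefl.
    have yb' : y != b' by apply: contraTneq by' => ->.
    by have [_ n _] := conf _ _ _ _ h Vy yb yb'; rewrite by' in n.
  have yb' : y != b' by apply: contraTneq by' => ->; rewrite adj_irrefl.
  have yb : y != b by apply: contraTneq by' => ->; rewrite adj_sym.
  by have [_ _ n] := conf _ _ _ _ h Vy yb yb'; rewrite by' in n.
have nbX a b b' : (a, b, b') \in Q' -> nb a :&: X' = [set b; b'].
  move=> h; have [/QP [Sa Sb Sb' ne [ab ab']] _ _ _] := Q'P _ h; have [Xb Xb'] := endX _ _ _ h.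
  apply/setP => y; rewrite in_setI in_nbr in_set2; apply/idP/idP.
    case/andP => ay /(subsetP sX') Vy; apply: contraT; rewrite negb_or => /andP [yb yb'].
    by have [n _ _] := conf _ _ _ _ h Vy yb yb'; rewrite ay in n.
  by case/orP => /eqP ->; rewrite ?ab ?ab' ?Xb ?Xb'.
apply: (@linkage_of_cherries _ D X' Q').
- by apply: leq_ltn_trans hU; rewrite leq_mul2l subset_leq_card ?orbT.
- move=> x y; rewrite inE => /andP [_ /eqP /setP /(_ y)]; rewrite in_set0 in_setI in_nbr => h Xy.
  by apply: contraFN h => ->; rewrite (subsetP sX' _ Xy).
- move=> a b b' h; have [/QP [_ _ _ ne _] _ _ _] := Q'P _ h; have [Xb Xb'] := endX _ _ _ h.
  by rewrite (nbX _ _ _ h).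
- move=> a a' b b' h h'.
  have [/QP [Sa Sb Sb' ne [ab ab']] _ _ _] := Q'P _ h.
  have [/QP [Sa' _ _ _ [a'b a'b']] _ _ _] := Q'P _ h'.
  by apply: (c4 Sb Sb' Sa Sa' ne); rewrite adj_sym.
- move=> [[a b] b'] [[c d] d'] h h' /=; apply/negP => ac.
  have [/QP [Sa Sb Sb' ne [ab ab']] _ _ nP] := Q'P _ h.
  have [/QP [Sc Sd Sd' ne' [cd cd']] _ _ _] := Q'P _ h'.
  have [/setIP [_ Ud] /setIP [_ Ud']] := inV _ _ _ h'.
  have nab x : adj c x -> x \notin [set b; b'].
    move=> cx; apply/negP; rewrite in_set2 => /orP [] /eqP E; move: cx; rewrite E; apply/negP.
      by apply: (tri Sa).
    by apply: (tri Sa).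
  have /negP [] : ~~ ([set d; d'] \subset U).
    apply: nP; rewrite inE cards2 ne' /=; apply/andP; split.
      rewrite disjoint_subset; apply/subsetP => x; rewrite in_set2 => hx.
      by rewrite inE; apply: nab; case/orP: hx => /eqP ->.
    apply/exists_inP; exists c; first by rewrite in_setI in_nbr ac.
    by rewrite subUset !sub1set !in_setI !in_nbr cd cd' Sd Sd'.
  by rewrite subUset !sub1set Ud.
Qed.

End GirthFive.

(** * The regular case: reaching girth five *)

Lemma expect_natsum (V : finType) (p : rat) (I : finType) (A : {set I}) (f : I -> {set V} -> nat) :
  expect p (fun U => (\sum_(i in A) f i U)%:R%R) =
  (\sum_(i in A) expect p (fun U => (f i U)%:R))%R.
Proof. by rewrite -expect_sum; apply: eq_bigr => U _; rewrite natr_sum. Qed.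

Lemma ler_sum_card (I : finType) (A : {set I}) (f : I -> rat) (c : rat) :
  (forall i, i \in A -> (f i <= c)%R) -> (\sum_(i in A) f i <= #|A|%:R * c)%R.
Proof. by move=> h; rewrite mulr_natl -sumr_const; apply: ler_sum. Qed.

Lemma penalty_lt (d l v q s s' a : nat) :
  (0 < d%:R * a%:R + ((-2) * q%:R + (- (2 * (d ^ 2)%:R) * (s%:R + s'%:R) +
     (- (d * l)%:R) * v%:R)) :> rat)%R ->
  d * l * v + 2 * q + 2 * d ^ 2 * (s + s') < d * a.
Proof.
move=> h; rewrite -(ltr_nat rat) !(natrD, natrM, natrX); move: h; rewrite natrM natrX.
lra.
Qed.

(** Here x is the expected size of the sample, y the expected number of its
    edges, Q that of its walks of length two with given centre, and u, v bound those of
    its triangles and four-cycles. *)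
Lemma expected_gain_gt0 (F : realFieldType) (d l K k z x y Q u v : F) :
  (0 < x -> 0 < l -> 1 <= K -> k = 16 * l -> 1 <= k -> d = 8 * (1 + K * k) ->
   k * x <= 4 * y -> Q <= y * (1 + K * k) -> 0 <= u -> 0 <= v ->
   128 * d * K ^+ 2 * k ^+ 2 <= z ->
   z * u <= 2 * K * k ^+ 2 * x -> z * v <= 2 * K ^+ 2 * k ^+ 3 * x ->
   0 < d * y + ((-2) * Q + (- (2 * d ^+ 2) * (u + v) + - (d * l) * x)))%R.
Proof.
move=> x0 l0 K1 kE k1 dE hy hQ u0 v0 hz hu hv.
have K0 : (0 < K)%R by lra.
have k0 : (0 < k)%R by lra.
have Kk : (0 < K * k)%R by rewrite mulr_gt0.
have d0 : (0 < d)%R by lra.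
have Kk1 : (1 <= K * k)%R by rewrite mulr_ege1.
have c0 : (0 < K ^+ 2 * k ^+ 2)%R by rewrite mulr_gt0 ?exprn_gt0.
have h1 : (2 * K * k ^+ 2 * x <= 2 * (K ^+ 2 * k ^+ 2) * (k * x))%R.
  have -> : (2 * (K ^+ 2 * k ^+ 2) * (k * x) = 2 * K * k ^+ 2 * x * (K * k) :> F)%R by ring.
  by apply: ler_peMr => //; rewrite !mulr_ge0 ?exprn_ge0 // ltW.
have h2 : (z * (u + v) <= 4 * (K ^+ 2 * k ^+ 2) * (k * x))%R.
  by rewrite mulrDr; move: h1 hu hv; rewrite (exprS k 2); lra.
have z0 : (0 < z)%R.
  by apply: lt_le_trans hz; rewrite -mulrA mulr_gt0 // mulr_gt0.
have h3 : (2 * d ^+ 2 * (u + v) <= d * l * x)%R.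
  rewrite -(ler_pM2l z0).
  have lhs : (z * (2 * d ^+ 2 * (u + v)) <= 2 * d ^+ 2 * (4 * (K ^+ 2 * k ^+ 2) * (k * x)))%R.
    have -> : (z * (2 * d ^+ 2 * (u + v)) = 2 * d ^+ 2 * (z * (u + v)) :> F)%R by ring.
    by rewrite ler_pM2l // mulr_gt0 ?exprn_gt0.
  apply: le_trans lhs _.
  have -> : (2 * d ^+ 2 * (4 * (K ^+ 2 * k ^+ 2) * (k * x)) =
     128 * d * K ^+ 2 * k ^+ 2 * (d * l * x) :> F)%R by rewrite kE; ring.
  by rewrite ler_pM2r // !mulr_gt0.
have h4 : (8 * Q <= d * y)%R by rewrite dE; lra.
have h5 : (4 * (d * l * x) <= d * y)%R.
  have -> : (4 * (d * l * x) = d * (4 * l * x) :> F)%R by ring.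
  by rewrite ler_pM2l //; move: hy; rewrite kE; lra.
have h6 : (0 < d * l * x)%R by rewrite !mulr_gt0.
lra.
Qed.

Lemma expected_gain (F : realFieldType) (p Q : F) (l K k z Dl m n e s3 s4 : nat) :
  (0 < p)%R -> (m%:R * p = k%:R)%R -> 0 < n -> 0 < l -> 0 < K -> k = 16 * l ->
  Dl = 8 * (1 + K * k) -> m * n <= 4 * e ->
  (Q <= e%:R * (p ^+ 2 + (K * m)%:R * p ^+ 3))%R ->
  128 * Dl * K ^ 2 * k ^ 2 <= z ->
  z * s3 <= 2 * K * m ^ 2 * n -> z * s4 <= 2 * K ^ 2 * m ^ 3 * n ->
  (0 < Dl%:R * (e%:R * p ^+ 2) + ((-2) * Q + (- (2 * Dl%:R ^+ 2) *
      (s3%:R * p ^+ 3 + s4%:R * p ^+ 4) + - (Dl%:R * l%:R) * (n%:R * p))))%R.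
Proof.
move=> p0 mp n0 l0 K0 kE dE dens' EQ zbig three four.
have x0 : (0 < n%:R * p)%R by apply: mulr_gt0 => //; rewrite ltr0n.
  have f1 : (0 < l%:R :> F)%R by rewrite ltr0n.
  have f2 : (1 <= K%:R :> F)%R by rewrite ler1n.
  have f3 : (k%:R = 16 * l%:R :> F)%R by rewrite kE natrM.
  have f4 : (1 <= k%:R :> F)%R by rewrite ler1n kE muln_gt0.
  have f5 : (Dl%:R = 8 * (1 + K%:R * k%:R) :> F)%R by rewrite dE natrM natrD natrM.
  have f6 : (k%:R * (n%:R * p) <= 4 * (e%:R * p ^+ 2))%R.
    have -> : (k%:R * (n%:R * p) = (m * n)%:R * p ^+ 2 :> F)%R.
        by rewrite -mp natrM; ring.
    have -> : (4 * (e%:R * p ^+ 2) = (4 * e)%:R * p ^+ 2 :> F)%R by rewrite natrM mulrA.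
      by rewrite ler_wpM2r ?exprn_ge0 ?(ltW p0) // ler_nat.
  have f7 : (Q <= e%:R * p ^+ 2 * (1 + K%:R * k%:R))%R.
      apply: le_trans EQ _; rewrite le_eqVlt; apply/orP; left; apply/eqP.
      by rewrite -mp natrM; ring.
  have f8 (j i : nat) : (0 <= j%:R * p ^+ i)%R.
      by apply: mulr_ge0; [exact: ler0n|exact: exprn_ge0 (ltW p0)].
  have f9 : (128 * Dl%:R * K%:R ^+ 2 * k%:R ^+ 2 <= z%:R :> F)%R.
      by rewrite -!natrX -!natrM ler_nat.
  have f10 : (z%:R * (s3%:R * p ^+ 3) <= 2 * K%:R * k%:R ^+ 2 * (n%:R * p))%R.
    have -> : (2 * K%:R * k%:R ^+ 2 * (n%:R * p) = (2 * K * m ^ 2 * n)%:R * p ^+ 3 :> F)%R.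
        by rewrite -mp (natrM _ (2 * K * m ^ 2)) (natrM _ (2 * K)) (natrM _ 2) natrX; ring.
      by rewrite mulrA -natrM ler_wpM2r ?exprn_ge0 ?(ltW p0) // ler_nat.
  have f11 : (z%:R * (s4%:R * p ^+ 4) <= 2 * K%:R ^+ 2 * k%:R ^+ 3 * (n%:R * p))%R.
    have -> : (2 * K%:R ^+ 2 * k%:R ^+ 3 * (n%:R * p) = (2 * K ^ 2 * m ^ 3 * n)%:R * p ^+ 4 :> F)%R.
        by rewrite -mp (natrM _ (2 * K ^ 2 * m ^ 3)) (natrM _ (2 * K ^ 2)) (natrM _ 2) !natrX; ring.
      by rewrite mulrA -natrM ler_wpM2r ?exprn_ge0 ?(ltW p0) // ler_nat.
  exact: (expected_gain_gt0 x0 f1 f2 f3 f4 f5 f6 f7 (f8 s3 3) (f8 s4 4) f9 f10 f11).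
Qed.

Section Regular.
Variables (G : sgraph) (m K z l : nat) (S : {set G}).
Let k := 16 * l.
Let Dl := 8 * (1 + K * k).
Hypotheses (l0 : 0 < l) (K0 : 0 < K) (km : k <= m) (S0 : S != set0).
Hypothesis deg : forall v, v \in S -> #|nb v :&: S| <= K * m.
Hypothesis dens : m * #|S| <= 4 * edge_count adj S S.
Hypothesis zbig : 128 * Dl * K ^ 2 * k ^ 2 <= z.
Hypothesis few : forall u, u \in S -> z * #|[set w in S | m < z * codegree S u w]| <= m.

Let N u := nb u :&: S.
Let cn u w := [set a in S | adj a u && adj a w].

Let k0 : 0 < k. Proof. by rewrite muln_gt0. Qed.
Let m0 : 0 < m. Proof. exact: leq_trans km. Qed.
Let Dl0 : 0 < Dl. Proof. by rewrite muln_gt0 addn_gt0. Qed.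

Lemma codegree_le u w : u \in S -> z * codegree S u w <= m + (m < z * codegree S u w) * (z * (K * m)).
Proof.
move=> Su; case: ltnP => [_|]; rewrite ?mul0n ?addn0 // mul1n.
apply: leq_trans (leq_addl _ _); rewrite leq_mul2l codegreeE; apply/orP; right.
by apply: leq_trans (deg Su); apply: subset_leq_card; apply: subsetIr.
Qed.

(** By [few], the vertices with more than m/z common neighbours with u contribute
    no more than the others to the cycle counts, even with the trivial bound Km. *)
Lemma heavy_sum u (B : {set G}) : u \in S -> B \subset S ->
  \sum_(w in B) (m < z * codegree S u w) * (z * (K * m)) <= m * (K * m).
Proof.
move=> Su sB; rewrite -big_distrl /= mulnA leq_mul2r; apply/orP; right.
apply: leq_trans (few Su); rewrite mulnC leq_mul2l; apply/orP; right.
rewrite -(card_setsum B (fun w => m < z * codegree S u w)); apply: subset_leq_card.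
by apply/subsetP => w; rewrite !inE => /andP [/(subsetP sB) -> ->].
Qed.

Lemma triangle_count :
  z * (\sum_(u in S) \sum_(v in N u) #|cn u v|) <= 2 * K * m ^ 2 * #|S|.
Proof.
rewrite [leqRHS]mulnC -sum_nat_const big_distrr /=; apply: leq_sum => u Su.
rewrite big_distrr /=; apply: (@leq_trans (\sum_(v in N u) (m + (m < z * codegree S u v) * (z * (K * m))))).
  by apply: leq_sum => v _; apply: codegree_le.
rewrite big_split /= sum_nat_const.
have h1 := heavy_sum Su (subsetIr (nb u) S); have h2 := deg Su; rewrite -/(N u) in h1 h2.
by move: h1 h2; move: (\sum_(_ in _) _) #|N u| => s d; clear; nia.
Qed.

Lemma four_cycle_count :
  z * (\sum_(u in S) \sum_(w in S) #|cn u w| ^ 2) <= 2 * K ^ 2 * m ^ 3 * #|S|.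
Proof.
rewrite [leqRHS]mulnC -sum_nat_const big_distrr /=; apply: leq_sum => u Su.
rewrite big_distrr /=.
have cK w : #|cn u w| <= K * m.
  by rewrite -/(codegree S u w) codegreeE; apply: leq_trans (deg Su); apply: subset_leq_card; apply: subsetIr.
apply: (@leq_trans (\sum_(w in S) (m * codegree S u w + (m < z * codegree S u w) * (z * (K * m)) * (K * m)))).
  apply: leq_sum => w _; have := codegree_le w Su; have := cK w; rewrite -/(codegree S u w).
  move: (codegree S u w) (_ * (z * (K * m))) => c h h1 h2.
  rewrite expnS expn1 mulnA; apply: leq_trans (leq_mul h2 (leqnn c)) _.
  by rewrite mulnDl leq_add2l leq_mul2l h1 orbT.
rewrite big_split /= -big_distrr -big_distrl /= sum_codegree edge_countC; last exact: adj_sym.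
have h1 := heavy_sum Su (subxx S).
have h2 : edge_count adj (nb u :&: S) S <= (K * m) * (K * m).
  apply: (@leq_trans (#|nb u :&: S| * (K * m))); last by rewrite leq_mul2r deg ?orbT.
  by rewrite -sum_nat_const; apply: leq_sum => x /setIP [_ Sx]; apply: deg.
apply: (@leq_trans (m * (K * m * (K * m)) + m * (K * m) * (K * m))).
  by apply: leq_add; [rewrite leq_mul2l h2 orbT|rewrite leq_mul2r h1 orbT].
by rewrite leq_eqVlt; apply/orP; left; apply/eqP; ring.
Qed.

Let e1 (U : {set G}) := \sum_(u in S) \sum_(v in N u) ([set u; v] \subset U).
Let q1u u (U : {set G}) := \sum_(v in N u) \sum_(w in N u) ([set u; v; w] \subset U).
Let t3u u (U : {set G}) := \sum_(v in N u) \sum_(w in cn u v) ([set u; v; w] \subset U).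
Let t4u u (U : {set G}) := \sum_(w in S :\ u) \sum_(x in cn u w) \sum_(y in cn u w :\ x)
  ([set u; w; x; y] \subset U).

Lemma subset2 (u v : G) (U : {set G}) : ([set u; v] \subset U) = (u \in U) && (v \in U).
Proof. by rewrite subUset !sub1set. Qed.

Lemma subset3 (u v w : G) (U : {set G}) :
  ([set u; v; w] \subset U) = [&& u \in U, v \in U & w \in U].
Proof. by rewrite !subUset !sub1set -andbA. Qed.

Let bad (U : {set G}) u := [|| Dl < #|nb u :&: (S :&: U)|, 0 < t3u u U | 0 < t4u u U].

(** A sampled vertex is discarded if its degree is above Dl or if it lies on a
    triangle or a four-cycle.  In the first case its degree is at most a 1/Dl
    fraction of the walks of length two centred at it; in the second case it
    loses at most Dl edges for a cycle. *)
Lemma cleaning_loss (U : {set G}) (V := S :&: U) (V' := [set u in V | ~~ bad U u]) :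
  Dl * e1 U <= Dl * edge_count adj V' V' + 2 * (\sum_(u in S) q1u u U)
    + 2 * Dl ^ 2 * (\sum_(u in S) t3u u U + \sum_(u in S) t4u u U).
Proof.
have sV' : V' \subset V by apply/subsetP => u; rewrite inE => /andP [].
have sum_NU u (f : G -> nat) : \sum_(v in N u) (v \in U) * f v = \sum_(v in nb u :&: V) f v.
  by rewrite -sum_setI; apply: eq_bigl => v; rewrite !inE andbC -andbA.
have E1 : e1 U = edge_count adj V V.
  rewrite /e1 /edge_count {1}/V setIC sum_setI; apply: eq_bigr => u _.
  rewrite -sum1_card -sum_NU big_distrr /=; apply: eq_bigr => v _.
  by rewrite subset2 muln1 mulnb.
have Q1 u : u \in V -> #|nb u :&: V| ^ 2 <= q1u u U.
  move=> /setIP [_ Uu]; rewrite /q1u expnS expn1 -[X in X * _]sum1_card -sum_NU big_distrl /=.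
  apply: leq_sum => v _; rewrite -[#|_|]sum1_card -sum_NU big_distrr /=.
  by apply: leq_sum => w _; rewrite subset3 Uu /= !muln1 mulnb.
have split_e : edge_count adj V V <= edge_count adj V' V' + 2 * \sum_(u in V :\: V') #|nb u :&: V|.
  have -> : edge_count adj V V = edge_count adj V' V + edge_count adj (V :\: V') V.
    rewrite /edge_count [LHS](bigID (mem V')) /=; congr (_ + _); apply: eq_bigl => u.
      by rewrite andb_idl // => /(subsetP sV').
    by rewrite in_setD andbC.
  have -> : edge_count adj V' V = edge_count adj V' V' + edge_count adj V' (V :\: V').
    rewrite /edge_count -big_split /=; apply: eq_bigr => u _.
    rewrite -(cardsID V' (nb u :&: V)) -setIA (setIidPr sV') setIDA.
    by [].
  rewrite (edge_countC (@adj_sym G) V' (V :\: V')).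
  have : edge_count adj (V :\: V') V' <= edge_count adj (V :\: V') V by apply: edge_countSr.
  by rewrite /edge_count; move: (\sum_(_ in _) _) (\sum_(_ in _) _) (\sum_(_ in _) _) => a b c; clear; lia.
have per u : u \in V :\: V' -> Dl * #|nb u :&: V| <= q1u u U + Dl ^ 2 * (t3u u U + t4u u U).
  rewrite !in_setD inE => /andP [h Vu]; move: h; rewrite Vu /= negbK => h.
  have := Q1 u Vu; move: h; rewrite /bad -/V; move: #|_| (q1u _ _) (t3u _ _) (t4u _ _) => d a b c.
  move: Dl => D'; clear => h h'.
  have [lt|ge] := ltnP D' d.
    apply: leq_trans (leq_addr _ _); apply: leq_trans h'.
    by rewrite expnS expn1 leq_mul2r ltnW ?orbT.
  have bc : 0 < b + c by move: h; rewrite ltnNge ge /= addn_gt0.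
  apply: leq_trans (leq_addl _ _); rewrite expnS expn1 -mulnA leq_mul2l.
  by rewrite (leq_trans ge) ?orbT // leq_pmulr.
have tot : Dl * \sum_(u in V :\: V') #|nb u :&: V| <=
    \sum_(u in S) q1u u U + Dl ^ 2 * (\sum_(u in S) t3u u U + \sum_(u in S) t4u u U).
  rewrite -big_split big_distrr /= big_distrr -big_split /=.
  apply: (@leq_trans (\sum_(u in V :\: V') (q1u u U + Dl ^ 2 * (t3u u U + t4u u U)))).
    by apply: leq_sum => u /per.
  rewrite [leqRHS](bigID (mem (V :\: V'))) /= -[leqLHS]addn0 leq_add //.
  rewrite [leqRHS](eq_bigl (mem (V :\: V'))) // => u; rewrite /= andb_idl //.
  by rewrite in_setD in_setI => /and3P [].
rewrite E1; apply: leq_trans (leq_mul (leqnn Dl) split_e) _.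
rewrite mulnDr mulnCA -addnA leq_add2l -mulnA -mulnDr leq_mul2l /=.
exact: tot.
Qed.

(** Sample at density p = k/m.  The expected number of edges is of order k|S|p,
    and the expected numbers of triangles and four-cycles are smaller than this
    by a factor of order z, because few pairs have more than m/z common neighbours. *)
Lemma girth_five_subset : exists V : {set G}, [/\ V \subset S, V != set0,
  l * #|V| <= edge_count adj V V, (forall v, v \in V -> #|nb v :&: V| <= Dl) &
  (forall u v w, u \in V -> v \in V -> w \in V -> adj u v -> adj u w -> ~~ adj v w) /\
  (forall u w x y, u \in V -> w \in V -> x \in V -> y \in V -> u != w ->
    adj u x -> adj w x -> adj u y -> adj w y -> x = y)].
Proof.
pose p : rat := (k%:R / m%:R)%R.
have p0 : (0 < p)%R by rewrite divr_gt0 ?ltr0n.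
have p1 : (p <= 1)%R by rewrite ler_pdivrMr ?ltr0n // mul1r ler_nat.
have mp : (m%:R * p = k%:R :> rat)%R by rewrite mulrC divfK // pnatr_eq0 -lt0n.
have card3 u v w : v \in N u -> w \in N u -> v != w -> #|[set u; v; w]| = 3.
  move=> /setIP []; rewrite in_nbr => uv _ /setIP []; rewrite in_nbr => uw _ vw.
  rewrite setUC cardsU1 cards2 !inE negb_or (eq_sym w v) vw andbT.
  have -> : u != v by apply: contraTneq uv => ->; rewrite adj_irrefl.
  by have -> : w != u by apply: contraTneq uw => ->; rewrite adj_irrefl.
pose e := edge_count adj S S; have dens' : m * #|S| <= 4 * e by [].
have E1 : expect p (fun U => (e1 U)%:R)%R = (e%:R * p ^+ 2)%R.
  rewrite /e1 expect_natsum /e /edge_count natr_sum mulr_suml; apply: eq_bigr => u _.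
  rewrite expect_natsum -/(N u) mulr_natl -sumr_const; apply: eq_bigr => v /setIP [].
  rewrite in_nbr => uv _; rewrite expect_subset cards2.
  by have -> : u != v by apply: contraTneq uv => ->; rewrite adj_irrefl.
have EQ : (expect p (fun U => (\sum_(u in S) q1u u U)%:R) <= e%:R * (p ^+ 2 + (K * m)%:R * p ^+ 3))%R.
  rewrite expect_natsum /e /edge_count natr_sum mulr_suml; apply: ler_sum => u Su.
  rewrite expect_natsum; apply: ler_sum_card => v Nv.
  rewrite expect_natsum (bigD1 v) //= expect_subset; apply: lerD.
    have -> : [set u; v; v] = [set u; v] by rewrite -setUA setUid.
    have uv : adj u v by move: Nv => /setIP []; rewrite in_nbr.
    rewrite cards2; have -> //: u != v by apply: contraTneq uv => ->; rewrite adj_irrefl.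
  rewrite (eq_bigr (fun=> p ^+ 3))%R => [|w /andP [Nw wv]]; last first.
    by rewrite expect_subset card3 // eq_sym.
  rewrite sumr_const -[leLHS]mulr_natl ler_wpM2r ?exprn_ge0 ?(ltW p0) // ler_nat.
  apply: leq_trans (deg Su); apply: subset_leq_card; apply/subsetP => w.
  by case/andP.
have ET : (expect p (fun U => (\sum_(u in S) t3u u U)%:R) =
    (\sum_(u in S) \sum_(v in N u) #|cn u v|)%:R * p ^+ 3)%R.
  rewrite expect_natsum natr_sum mulr_suml; apply: eq_bigr => u Su.
  rewrite expect_natsum natr_sum mulr_suml; apply: eq_bigr => v Nv.
  rewrite expect_natsum mulr_natl -sumr_const; apply: eq_bigr => w.
  rewrite inE => /and3P [Sw wu wv]; rewrite expect_subset card3 //.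
    by rewrite in_setI in_nbr adj_sym wu.
  by apply: contraTneq wv => ->; rewrite adj_irrefl.
have EF : (expect p (fun U => (\sum_(u in S) t4u u U)%:R) <=
    (\sum_(u in S) \sum_(w in S) #|cn u w| ^ 2)%:R * p ^+ 4)%R.
  rewrite expect_natsum natr_sum mulr_suml; apply: ler_sum => u Su.
  rewrite expect_natsum natr_sum mulr_suml [leRHS](big_setD1 u) //= -[leLHS]add0r lerD //.
    by rewrite mulr_ge0 ?exprn_ge0 ?(ltW p0).
  apply: ler_sum => w; rewrite in_setD1 => /andP [wu Sw].
  rewrite expect_natsum natrX expr2 -mulrA; apply: ler_sum_card => x.
  rewrite inE => /and3P [Sx xu xw].
  rewrite expect_natsum (le_trans (ler_sum_card (c := (p ^+ 4)%R) _)) //.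
    move=> y; rewrite !inE => /and4P [yx Sy yu yw]; rewrite expect_subset.
    have ne (a b : G) : adj a b -> a != b by move=> ab; apply: contraTneq ab => ->; rewrite adj_irrefl.
    have -> : #|[set u; w; x; y]| = 4; last by [].
    rewrite (setUC _ [set y]) cardsU1 (setUC _ [set x]) cardsU1 cards2 !inE !negb_or.
    by rewrite yx (ne y u) // (ne y w) // (ne x u) // (ne x w) // eq_sym wu.
  by rewrite ler_wpM2r ?exprn_ge0 ?(ltW p0) // ler_nat subset_leq_card // subsetDl.
pose F (U : {set G}) : rat := (Dl%:R * (e1 U)%:R + ((- 2) * (\sum_(u in S) q1u u U)%:R +
  ((- (2 * (Dl ^ 2)%:R)) * ((\sum_(u in S) t3u u U)%:R + (\sum_(u in S) t4u u U)%:R) +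
  (- (Dl * l)%:R) * (\sum_(u in S) ([set u] \subset U))%:R)))%R.
have [|U FU] := @expect_gt0 _ p p0 p1 F.
  rewrite /F !(expectD, expectZ) E1 ET.
  have -> : expect p (fun U => (\sum_(u in S) ([set u] \subset U))%:R)%R = (#|S|%:R * p)%R.
    rewrite expect_natsum mulr_natl -sumr_const; apply: eq_bigr => u _.
    by rewrite expect_subset cards1.
  have three := triangle_count; have four := four_cycle_count.
  move: EQ EF three four; move: (expect _ _) (expect _ _) => T4 Q.
  set s3 := \sum_(u in S) \sum_(v in N u) #|cn u v|.
  set s4 := \sum_(u in S) \sum_(w in S) #|cn u w| ^ 2 => EQ EF three four.
  have gain : (0 < Dl%:R * (e%:R * p ^+ 2) + ((-2) * Q + (- (2 * Dl%:R ^+ 2) *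
      (s3%:R * p ^+ 3 + s4%:R * p ^+ 4) + - (Dl%:R * l%:R) * (#|S|%:R * p))))%R.
    apply: (@expected_gain _ p Q l K k z Dl m #|S| e s3 s4 p0 mp _ l0 K0 (erefl _)
      (erefl _) dens' EQ zbig three four).
    by rewrite card_gt0.
  apply: lt_le_trans gain _; rewrite natrX natrM.
  rewrite !lerD2l lerD2r !mulNr lerN2 ler_wpM2l ?mulr_ge0 ?exprn_ge0 //.
  by rewrite lerD2l.
exists [set u in S :&: U | ~~ bad U u]; have loss := cleaning_loss U.
set V' := [set u in S :&: U | _] in loss *.
have sV' : V' \subset S :&: U by apply/subsetP => u; rewrite inE => /andP [].
have lt : l * #|S :&: U| < edge_count adj V' V'.
  have Fn : Dl * l * #|S :&: U| + 2 * (\sum_(u in S) q1u u U) +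
     2 * Dl ^ 2 * (\sum_(u in S) t3u u U + \sum_(u in S) t4u u U) < Dl * e1 U.
    apply: penalty_lt; move: FU; rewrite /F.
    have -> : #|S :&: U| = \sum_(u in S) ([set u] \subset U).
      by rewrite setIC card_setIE; apply: eq_bigr => u _; rewrite sub1set.
    exact.
  rewrite -(ltn_pmul2l Dl0) mulnA -(ltn_add2r (2 * (\sum_(u in S) q1u u U) +
    2 * Dl ^ 2 * (\sum_(u in S) t3u u U + \sum_(u in S) t4u u U))).
  rewrite (addnA (Dl * l * _)) (addnA (Dl * edge_count _ _ _)); exact: leq_trans Fn loss.
have inU u : u \in V' -> [/\ u \in S, u \in U & ~~ bad U u].
  by rewrite !inE => /andP [/andP [-> ->] ->].
split.
- by apply: subset_trans sV' (subsetIl _ _).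
- by apply: contraTneq lt => ->; rewrite /edge_count big_set0.
- by apply: leq_trans (ltnW lt); rewrite leq_mul2l subset_leq_card ?orbT.
- move=> v /inU [_ _]; rewrite /bad !negb_or -leqNgt => /and3P [h _ _]; apply: leq_trans h.
  by apply: subset_leq_card; apply: setIS.
split.
  move=> u v w /inU [Su Uu bu] /inU [Sv Uv _] /inU [Sw Uw _] uv uw; apply/negP => vw.
  move: bu; rewrite /bad !negb_or -!leqNgt !leqn0 => /and3P [_ + _].
  rewrite /t3u sum_nat_eq0 => /forall_inP /(_ v); rewrite in_setI in_nbr uv Sv => /(_ isT).
  rewrite sum_nat_eq0 => /forall_inP /(_ w); rewrite inE Sw adj_sym uw adj_sym vw => /(_ isT).
  by rewrite subset3 Uu Uv Uw.
move=> u w x y /inU [Su Uu bu] /inU [Sw Uw _] /inU [Sx Ux _] /inU [Sy Uy _] uw ux wx uy wy.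
apply/eqP; apply: contraT => xy.
move: bu; rewrite /bad !negb_or -!leqNgt !leqn0 => /and3P [_ _ +].
rewrite /t4u sum_nat_eq0 => /forall_inP /(_ w); rewrite in_setD1 eq_sym uw Sw => /(_ isT).
rewrite sum_nat_eq0 => /forall_inP /(_ x); rewrite inE Sx adj_sym ux adj_sym wx => /(_ isT).
rewrite sum_nat_eq0 => /forall_inP /(_ y); rewrite !inE eq_sym xy Sy adj_sym uy adj_sym wy => /(_ isT).
by rewrite !subUset !sub1set Uu Uw Ux Uy.
Qed.

End Regular.

(** * The dichotomy *)

(** With l of order s and M of order s^2, the quantity Dl is of order s, so that
    all the inequalities hold once s is large. *)
Fact scale_ineqs (d K s : nat) : 0 < d -> 0 < K -> s = (1088 * K) ^ 3 * d ->
  let l := 8 * d * s in let M := 8 * d * s ^ 2 in let Dl := 8 * (1 + K * (16 * l)) in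
  [/\ 0 < s, 12 * Dl <= M, 4 * Dl ^ 3 <= M ^ 2 & 4 * d * M < l ^ 2].
Proof.
move=> d0 K0 sE l M Dl.
set b := 1088 * K in sE.
have b2 : 2 <= b by rewrite /b; lia.
have b0 : 0 < b by apply: leq_trans b2.
have s0 : 0 < s by rewrite sE muln_gt0 expn_gt0 b0.
have hD : Dl <= b * d * s.
  have x0 : 0 < K * d * s by rewrite !muln_gt0 K0 d0 s0.
  have -> : b * d * s = 1088 * (K * d * s) by rewrite /b; ring.
  have -> : Dl = 8 + 1024 * (K * d * s) by rewrite /Dl /l; ring.
  by move: x0; clear; lia.
have bs : 2 * b <= s.
  rewrite sE expnSr mulnAC leq_mul2r; apply/orP; right; apply: leq_trans b2 _.
  by rewrite expnS expn1 -mulnA leq_pmulr // muln_gt0 b0.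
split=> //.
- apply: leq_trans (leq_mul (leqnn 12) hD) _; rewrite /M.
  have -> : 12 * (b * d * s) = 6 * (2 * b) * (d * s) by ring.
  have -> : 8 * d * s ^ 2 = 8 * s * (d * s) by ring.
  by rewrite leq_mul2r leq_mul ?orbT.
- have h : Dl ^ 3 <= (b * d * s) ^ 3 by rewrite leq_exp2r.
  apply: leq_trans (leq_mul (leqnn 4) h) _.
  have -> : 4 * (b * d * s) ^ 3 = 4 * (b ^ 3 * d) * (d ^ 2 * s ^ 3) by ring.
  rewrite -sE /M; have -> : (8 * d * s ^ 2) ^ 2 = 64 * s * (d ^ 2 * s ^ 3) by ring.
  by rewrite leq_mul2r leq_mul ?orbT.
- rewrite /M /l; have -> : 4 * d * (8 * d * s ^ 2) = 32 * (d * s) ^ 2 by ring.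
  have -> : (8 * d * s) ^ 2 = 64 * (d * s) ^ 2 by ring.
  by rewrite ltn_mul2r expn_gt0 muln_gt0 d0 s0.
Qed.

Lemma regular_parameters D K : 0 < K -> exists l M z : nat,
  let Dl := 8 * (1 + K * (16 * l)) in
  [/\ 2 <= l, 0 < M, 12 * Dl <= M, 4 * Dl ^ 3 <= M ^ 2 &
   [/\ 4 * D * M < l ^ 2, 0 < z & 128 * Dl * K ^ 2 * (16 * l) ^ 2 <= z]].
Proof.
move=> K0; have [s0 h1 h2 h3] := scale_ineqs (ltn0Sn D) K0 (erefl _).
move: (_ * D.+1) s0 h1 h2 h3 => s s0 h1 h2 h3.
exists (8 * D.+1 * s), (8 * D.+1 * s ^ 2), (128 * (8 * (1 + K * (16 * (8 * D.+1 * s)))) * K ^ 2 * (16 * (8 * D.+1 * s)) ^ 2).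
have l2 : 2 <= 8 * D.+1 * s by move: s0; clear; nia.
have l0 := ltnW l2.
split=> //; first by rewrite muln_gt0 expn_gt0 s0.
split=> //; first by apply: leq_ltn_trans h3; rewrite leq_mul2r leq_mul2l leqnSn !orbT.
move: (8 * D.+1 * s) l0 => l l0.
by rewrite muln_gt0 expn_gt0 (muln_gt0 16) l0 muln_gt0 expn_gt0 K0.
Qed.

Section RegularCase.
Variables (G : sgraph) (q t D K m l M z : nat) (S : {set G}).
Let Dl := 8 * (1 + K * (16 * l)).
Hypotheses (rich : nonadjacency_rich q t G) (q0 : 0 < q) (t0 : 0 < t) (K0 : 0 < K).
Hypotheses (l2 : 2 <= l) (M0 : 0 < M) (M1 : 12 * Dl <= M) (M2 : 4 * Dl ^ 3 <= M ^ 2)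
  (M3 : 4 * D * M < l ^ 2) (z0 : 0 < z) (zbig : 128 * Dl * K ^ 2 * (16 * l) ^ 2 <= z).
Hypotheses (km : 16 * l <= m) (zm : z * dense_const q D (z * K) * t <= m).
Hypotheses (S0 : S != set0) (deg : forall v, v \in S -> #|nb v :&: S| <= K * m)
  (dens : m * #|S| <= 4 * edge_count adj S S).

(** If for some u more than m/z vertices have more than m/z common neighbours with u, they
    form a dense pair with the neighbourhood of u. *)
Lemma regular_case : dense_linkage D G.
Proof.
pose R u := [set w in S | m < z * codegree S u w].
have [/exists_inP [u Su big]|] := boolP [exists u in S, m < z * #|R u|].
  have [w Rw] : exists w, w \in R u.
    by apply/card_gt0P; move: big; case: #|R u| => //; rewrite muln0.
  have hA : m < z * #|nb u :&: S|.
    move: Rw; rewrite inE => /andP [_ /leq_trans]; apply.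
    by rewrite leq_mul2l codegreeE subset_leq_card ?orbT // subsetIr.
  apply: (@dense_pair_linkage G q t rich q0 t0 D (z * K) (nb u :&: S) (R u)).
  - by rewrite muln_gt0 z0.
  - by rewrite -(leq_pmul2l z0) mulnA (leq_trans zm) // ltnW.
  - by rewrite -(leq_pmul2l z0) mulnA (leq_trans zm) // ltnW.
  - rewrite edge_countC -?sum_codegree; last exact: adj_sym.
    have : m * #|R u| <= z * \sum_(y in R u) codegree S u y.
      rewrite mulnC -sum_nat_const big_distrr /=; apply: leq_sum => y.
      by rewrite inE => /andP [_ /ltnW].
    move=> h; apply: leq_trans (leq_mul (deg Su) (leqnn _)) _.
    by rewrite -mulnA [X in _ <= X * _]mulnC -mulnA leq_mul2l h orbT.
rewrite negb_exists_in => /forall_inP few.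
have few' u : u \in S -> z * #|R u| <= m by move=> /few; rewrite -leqNgt.
have [V [sV V0 dV degV [tri c4]]] :=
  girth_five_subset (ltnW l2) K0 km S0 deg dens zbig few'.
exact: (girth_five_linkage tri c4 degV V0 dV l2 M0 M1 M2 M3).
Qed.

End RegularCase.

Lemma edge_countUl (T : finType) (e : rel T) (A B C : {set T}) : [disjoint A & B] ->
  edge_count e (A :|: B) C = edge_count e A C + edge_count e B C.
Proof.
move=> dis; rewrite /edge_count -bigU //=; apply: eq_bigl => x; by rewrite !inE.
Qed.

Lemma edge_countU (G : sgraph) (A B : {set G}) : [disjoint A & B] ->
  edge_count adj (A :|: B) (A :|: B) =
  edge_count adj A A + 2 * edge_count adj A B + edge_count adj B B.
Proof.
move=> dis; have s := @adj_sym G.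
rewrite edge_countUl // (edge_countC s A) (edge_countC s B) !edge_countUl //.
by rewrite (edge_countC s B A); lia.
Qed.

(** Cleaning keeps the vertices whose cherries number at least their degree times
    m over twice this factor. *)
Definition clean_factor q := 4096 * q.
(** The weight over m^2 that [unbalanced_linkage] requires at each vertex. *)
Definition pair_weight D := (648 * D).+1.
(** The threshold K that separates the degrees: a vertex is high if its degree
    exceeds K times m. *)
Definition split_ratio q D := 32 + 2 * (clean_factor q * (4 * pair_weight D)).

(** Take m maximal such that some nonempty S satisfies the lower bound. *)
Lemma densest_subset (G : sgraph) (m0 : nat) : 0 < m0 -> 0 < #|G| ->
  m0 * #|G| <= edge_count adj [set: G] [set: G] ->
  exists m (S : {set G}), [/\ m0 <= m, S != set0, m * #|S| <= edge_count adj S S &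
    forall Y : {set G}, edge_count adj Y Y <= 2 * m * #|Y|].
Proof.
move=> m00 G0 dens.
pose P m := [exists S : {set G}, (S != set0) && (m * #|S| <= edge_count adj S S)].
have P0 : P m0.
  apply/existsP; exists [set: G]; rewrite cardsT dens andbT -card_gt0 cardsT //.
have ub m : P m -> m <= #|G|.
  case/existsP => S /andP [S0 h]; rewrite -card_gt0 in S0.
  rewrite -(leq_pmul2r S0); apply: leq_trans h _.
  by rewrite mulnC -sum_nat_const; apply: leq_sum => x _; apply: max_card.
have exP : exists m, P m by exists m0.
case: (ex_maxnP exP ub) => m /existsP [S /andP [S0 h]] mx.
exists m, S; have m0m := mx _ P0; split=> // Y.
have [->|Y0] := eqVneq Y set0; first by rewrite /edge_count big_set0.
rewrite leqNgt; apply/negP => lt; have : P m.+1.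
  apply/existsP; exists Y; rewrite Y0 /=; apply: leq_trans (ltnW lt).
  by rewrite leq_mul2r; apply/orP; right; lia.
by move=> /mx; rewrite ltnn.
Qed.

(** The high vertices number at most 2n/K, so that the edges among them are
    negligible; the remaining ones decide between the two cases.  In the
    unbalanced case, vertices with more than 2m neighbours in Hi are discarded:
    the density bound applied to them together with Hi shows that they carry at
    most 2m|Hi| edges. *)
Lemma dense_linkage_of_degree q D : 0 < q -> exists C : nat, 0 < C /\
  forall (G : sgraph) t, nonadjacency_rich q t G -> 0 < t -> 0 < #|G| ->
  C * t * #|G| <= edge_count adj [set: G] [set: G] -> dense_linkage D G.
Proof.
move=> q0; pose K := split_ratio q D; have K0 : 0 < K by [].
have [l [M [z [l2 M0 M1 M2 [M3 z0 zbig]]]]] := regular_parameters D K0.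
(* The summands are the lower bounds on m / t that the two cases require. *)
exists (32 + 32 * q + 4 * clean_factor q * dense_const q D (4 * clean_factor q * pair_weight D) +
  16 * l + z * dense_const q D (z * K)); split=> // G t rich t0 G0 dens.
set C := _ + _ in dens; have C0 : 0 < C * t by rewrite muln_gt0 t0 andbT.
have [m [S [hm S0 eS sp]]] := densest_subset C0 G0 dens.
have bounds : [/\ 32 * t <= m, 32 * q <= m,
    4 * clean_factor q * dense_const q D (4 * clean_factor q * pair_weight D) * t <= m,
    16 * l <= m & z * dense_const q D (z * K) * t <= m].
  move: hm; rewrite /C {C dens C0}.
  move: (4 * clean_factor q * _) (16 * l) (z * dense_const _ _ _) t0 => a b c; clear.
  by rewrite !mulnDl => t0 h; split; nia.
have [tm qm dm km zm] := bounds.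
have m0 : 0 < m by apply: leq_trans hm.
pose n := #|S|; have n0 : 0 < n by rewrite card_gt0.
pose Hi := [set v in S | K * m < #|nb v :&: S|]; pose A0 := S :\: Hi.
have sHi : Hi \subset S by apply/subsetP => v; rewrite inE => /andP [].
have dis0 : [disjoint A0 & Hi].
  by rewrite disjoint_subset; apply/subsetP => v; rewrite !inE => /andP [].
have SE : A0 :|: Hi = S by rewrite -[RHS](setID S Hi) (setIidPr sHi) setUC.
have cHi : K * #|Hi| <= 2 * n.
  have h : #|Hi| * (K * m) <= edge_count adj S S.
    apply: leq_trans (edge_countSl (@adj_sym G) S sHi); rewrite -sum_nat_const.
    by apply: leq_sum => v; rewrite inE => /andP [_ /ltnW].
  rewrite -(leq_pmul2r m0); move: h (sp S); rewrite -/n; move: (edge_count _ _ _) => e.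
  by clear; nia.
have [c32 cz] : 16 * #|Hi| <= n /\ clean_factor q * (4 * pair_weight D) * #|Hi| <= n.
  move: cHi; rewrite /K /split_ratio; move: (clean_factor q * _) => x; clear; nia.
have cA0 : #|A0| <= n by apply: subset_leq_card; apply: subsetDl.
have degA0 v : v \in A0 -> #|nb v :&: A0| <= K * m.
  rewrite !inE => /andP [h Sv]; rewrite Sv /= -leqNgt in h; apply: leq_trans h.
  by apply: subset_leq_card; apply: setIS; apply: subsetDl.
have [reg|irr] := leqP (m * n) (4 * edge_count adj A0 A0).
  apply: (regular_case rich q0 t0 K0 l2 M0 M1 M2 M3 z0 zbig km zm _ degA0).
    apply: contraTneq reg => ->; rewrite /edge_count big_set0 muln0 -ltnNge muln_gt0 m0 //.
  by apply: leq_trans reg; rewrite leq_mul2l cA0 orbT.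
have cross : m * n <= 4 * edge_count adj A0 Hi.
  move: eS (sp Hi) irr c32; rewrite -/n -{1 2}SE edge_countU //.
  by move: (edge_count _ _ _) (edge_count _ _ _) (edge_count _ _ _) => a b c; clear; nia.
pose A := [set a in A0 | #|nb a :&: Hi| <= 2 * m]; pose A1 := A0 :\: A.
have sA : A \subset A0 by apply/subsetP => a; rewrite inE => /andP [].
have disA : [disjoint A & Hi] by apply: disjointWl dis0.
have few_high : edge_count adj A1 Hi <= 2 * m * #|Hi|.
  have dis1 : [disjoint A1 & Hi] by apply: disjointWl dis0; apply: subsetDl.
  have h : 2 * m * #|A1| <= edge_count adj A1 Hi.
    rewrite mulnC -sum_nat_const; apply: leq_sum => a; rewrite !inE => /andP [h aA0].
    by rewrite aA0 /= -ltnNge in h; apply: ltnW.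
  have := sp (A1 :|: Hi); rewrite edge_countU // cardsU (disjoint_setI0 dis1) cards0 subn0.
  move: h; move: (edge_count _ _ _) (edge_count _ _ _) (edge_count _ _ _) => a b c.
  by move: #|A1| #|Hi| => x y; clear; nia.
have eA : m * n <= 8 * edge_count adj A Hi.
  have E : edge_count adj A0 Hi = edge_count adj A Hi + edge_count adj A1 Hi.
    rewrite -edge_countUl; last by rewrite disjoint_sym disjoint_subset; apply/subsetP => a; rewrite !inE => /andP [].
    by rewrite -[in LHS](setID A0 A) (setIidPr sA).
  move: cross few_high c32; rewrite E; move: (edge_count _ _ _) (edge_count _ _ _) => a b.
  by clear; nia.
apply: (unbalanced_case rich q0 t0 n0 tm qm dm disA sp _ _ cz eA).
- by move=> a; rewrite inE => /andP [].
- by apply: leq_trans (subset_leq_card sA) cA0.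
Qed.

Local Open Scope ring_scope.

Theorem theorem1p11 (R : realType) (c : R) (hc : 0 < c) (H : sgraph) :
  exists C : R, forall t : nat, (0 < t)%N ->
    forall G : sgraph, sparse c t G ->
      C * t%:R <= average_degree R G ->
      contains_induced_subdivision G H.
Proof.
have [D HD] := dense_linkage_subdivision H.
pose q := (Num.bound c^-1).+1.
have cq : 1 <= c * q%:R.
  have h : c^-1 < (Num.bound c^-1)%:R by apply: archi_boundP; rewrite invr_ge0 ltW.
  rewrite -ler_pdivrMl // mulr1; apply: le_trans (ltW h) _.
  by rewrite ler_nat.
have [C [C0 HC]] := dense_linkage_of_degree D (ltn0Sn _ : 0 < q)%N.
exists C%:R => t t0 G sp avg.
have Ct : 0 < C%:R * t%:R :> R by rewrite -natrM ltr0n muln_gt0 C0.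
have G0 : (0 < #|G|)%N.
  rewrite lt0n; apply/eqP => G0; move: (lt_le_trans Ct avg).
  by rewrite /average_degree G0 invr0 mulr0 ltxx.
apply: HD; apply: (HC G t) => //; first exact: sparse_rich cq sp.
move: avg; rewrite /average_degree ler_pdivlMr ?ltr0n // -!natrM ler_nat.
move/leq_trans; apply; rewrite /edge_count leq_eqVlt; apply/orP; left; apply/eqP.
by apply: eq_big => [v|v _]; rewrite ?in_setT // setIT.
Qed.
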